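(* For a partition $\lambda=(\lambda_1,\dots,\lambda_r)$ of length $r\le n$, the universal Schur function of Kempf–Laksov type $s^{\mathbb L,KL}_\lambda(x_1,\dots,x_n)$ is the coefficient of $u_1^{-\lambda_1}\cdots u_r^{-\lambda_r}$ in $$\prod_{i=1}^r\Big(\frac{1}{\mathscr P(u_i)}\prod_{j=1}^n\frac{u_i}{u_i+_{\mathbb L}\bar x_j}\Big)\prod_{1\le i<j\le r}\frac{u_j+_{\mathbb L}\bar u_i}{u_j}.$$
   Context: $\mathbb L$ is the Lazard ring, $F_{\mathbb L}(u,v)=u+v+\sum_{i,j\ge1}a_{i,j}u^iv^j$ the universal formal group law, $u+_{\mathbb L}v:=F_{\mathbb L}(u,v)$, $\bar u$ the formal inverse. $\mathscr P(z):=1+\sum_{i\ge1}a_{i,1}z^i$. $x_1,\dots,x_n$ are indeterminates. Definition: for a partition $\lambda$ of length $r\le n$, $s^{\mathbb L,KL}_\lambda(x_1,\dots,x_n):=\sum_{\bar w\in S_n/(S_1)^r\times S_{n-r}}w\cdot\Big[\prod_{i=1}^r x_i^{\lambda_i-i+n}\big/\prod_{i=1}^r\prod_{j=i+1}^n(x_i+_{\mathbb L}\bar x_j)\Big]$, $S_n$ permuting the $x$'s, sum over coset representatives (a symmetric formal power series in $x_1,\dots,x_n$ over $\mathbb L$). Expansion convention: the expression is expanded as a formal series in $x_1,\dots,x_n$ (factors $1/(u_i+_{\mathbb L}\bar x_j)$ expanded in powers of $x_j$), $1/\mathscr P(u_i)$ and $u_j+_{\mathbb L}\bar u_i$ are power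 series, so each $x$-coefficient is a Laurent series in $u_1,\dots,u_r$ with finitely many negative powers; the coefficient of $u^{-\lambda}$ is taken there. *)

(* Defs.v *)
(* Formal power series are encoded as coefficient functions
   over exponent vectors. *)
From HB Require Import structures.
From mathcomp Require Import all_boot all_order all_algebra.
Set Implicit Arguments. Unset Strict Implicit. Unset Printing Implicit Defensive.
Import GRing.Theory.
Local Open Scope ring_scope.

Section Series.
Variable R : comNzRingType.

Definition ps (V : finType) := (V -> nat) -> R.
Definition mdeg (V : finType) (m : V -> nat) : nat := (\sum_(v : V) m v)%N.

Definition ps_zero (V : finType) : ps V := fun _ => 0.
Definition ps_add (V : finType) (f g : ps V) : ps V := fun m => f m + g m.
Definition ps_opp (V : finType) (f : ps V) : ps V := fun m => - f m.
Definition ps_one (V : finType) : ps V :=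
  fun m => if [forall v, m v == 0%N] then 1 else 0.
Definition ps_var (V : finType) (w : V) : ps V :=
  fun m => if [forall v, m v == nat_of_bool (v == w)] then 1 else 0.
Definition ps_mul (V : finType) (f g : ps V) : ps V := fun m =>
  \sum_(b : {ffun V -> 'I_(mdeg m).+1} | [forall v, (b v <= m v)%N])
     f (fun v => nat_of_ord (b v)) * g (fun v => (m v - b v)%N).
Definition ps_exp (V : finType) (f : ps V) (k : nat) : ps V :=
  iter k (ps_mul f) (@ps_one V).
Definition ps_prod (V : finType) (s : seq (ps V)) : ps V :=
  foldr (@ps_mul V) (@ps_one V) s.
(* substitution of g (with zero constant term) into the one-variable
   series with coefficients c *)
Definition ps_comp1 (V : finType) (c : nat -> R) (g : ps V) : ps V :=
  fun m => \sum_(k < (mdeg m).+1) c k * ps_exp g k m.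

Section FGL.
(* a i j (i, j >= 1) are the coefficients of
   F(u,v) = u + v + sum_{i,j>=1} a_{i,j} u^i v^j *)
Variable a : nat -> nat -> R.

(* A +_F B, for A, B with zero constant term *)
Definition fgl_eval (V : finType) (A B : ps V) : ps V := fun m =>
  A m + B m +
  \sum_(k < (mdeg m).+1) \sum_(l < (mdeg m).+1)
     (if (0 < k)%N && (0 < l)%N
      then a k l * ps_mul (ps_exp A k) (ps_exp B l) m else 0).

Definition is_fgl : Prop :=
  (forall i j, a i j = a j i) /\
  forall m : 'I_3 -> nat,
    fgl_eval (fgl_eval (ps_var (@inord 2 0)) (ps_var (@inord 2 1)))
             (ps_var (@inord 2 2)) m =
    fgl_eval (ps_var (@inord 2 0))
             (fgl_eval (ps_var (@inord 2 1)) (ps_var (@inord 2 2))) m.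

(* formal inverse iota(z) = sum_m iota_m z^m, the unique series with
   F(z, iota(z)) = 0; coefficients computed recursively:
   iota_m = - [z^m] ( z + sum_{k,l>=1} a_{k,l} z^k iota(z)^l ),
   where the right-hand side only involves iota_0 .. iota_{m-1}. *)
Definition fgl_inv_next (L : seq R) (m : nat) : R :=
  - ((nat_of_bool (m == 1%N))%:R +
     \sum_(k < m.+1) \sum_(l < m.+1)
        (if (0 < k)%N && (0 < l)%N
         then a k l * ('X^k * (Poly L) ^+ l)`_m else 0)).
Fixpoint fgl_inv_list (m : nat) : seq R :=
  match m with
  | 0 => [:: 0]
  | m'.+1 => let L := fgl_inv_list m' in rcons L (fgl_inv_next L m)
  end.
Definition fgl_inv_coef (m : nat) : R := nth 0 (fgl_inv_list m) m.
Definition ps_bar (V : finType) (g : ps V) : ps V := ps_comp1 fgl_inv_coef g.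

(* coefficients of 1/P(z), P(z) = 1 + sum_{i>=1} a_{i,1} z^i *)
Definition invP_coef (m : nat) : R :=
  (\sum_(k < m.+1) (- \sum_(1 <= i < m.+1) (a i 1%N *: 'X^i)) ^+ k)`_m.

End FGL.

(* ---------- the ring R((u_1..u_r))[[x_1..x_n]] ----------
   An element E represents  sum_al x^al u^{-(lsh E al)(1,..,1)}
   sum_ga (lco E al ga) u^ga,  i.e. for each x-monomial a Laurent series in
   u_1..u_r with finitely many negative powers (bounded below). *)
Record ls (n r : nat) := LS {
  lsh : ('I_n -> nat) -> nat;
  lco : ('I_n -> nat) -> ('I_r -> nat) -> R }.

Section LS.
Variables n r : nat.
Implicit Types E : ls n r.

Definition ls_of_ps (f : ps ('I_r + 'I_n)%type) : ls n r :=
  LS (fun _ => 0%N)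
     (fun al ga => f (fun v => match v with inl i => ga i | inr j => al j end)).
Definition ls_zero : ls n r := LS (fun _ => 0%N) (fun _ _ => 0).
Definition ls_one : ls n r := ls_of_ps (@ps_one _).
Definition ls_opp E : ls n r := LS (lsh E) (fun al ga => - lco E al ga).
(* coefficients of E re-expressed with respect to a larger shift N *)
Definition ls_co_at E (N : ('I_n -> nat) -> nat) al (ga : 'I_r -> nat) : R :=
  let d := (N al - lsh E al)%N in
  if [forall i, (d <= ga i)%N] then lco E al (fun i => (ga i - d)%N) else 0.
Definition ls_add E1 E2 : ls n r :=
  let N := fun al => maxn (lsh E1 al) (lsh E2 al) in
  LS N (fun al ga => ls_co_at E1 N al ga + ls_co_at E2 N al ga).
Definition ls_mul E1 E2 : ls n r :=
  let N := fun al =>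
    (\max_(b : {ffun 'I_n -> 'I_(mdeg al).+1} | [forall j, (b j <= al j)%N])
       (lsh E1 (fun j => nat_of_ord (b j)) + lsh E2 (fun j => al j - b j)))%N in
  LS N (fun al ga =>
    \sum_(b : {ffun 'I_n -> 'I_(mdeg al).+1} | [forall j, (b j <= al j)%N])
      let b1 := fun j => nat_of_ord (b j) in
      let b2 := fun j => (al j - b j)%N in
      let d := (N al - (lsh E1 b1 + lsh E2 b2))%N in
      if [forall i, (d <= ga i)%N] then
        \sum_(c : {ffun 'I_r -> 'I_(mdeg (fun i => ga i - d)%N).+1}
                | [forall i, (c i <= ga i - d)%N])
          lco E1 b1 (fun i => nat_of_ord (c i)) *
          lco E2 b2 (fun i => ga i - d - c i)%N
      else 0).
Definition ls_exp E k : ls n r := iter k (ls_mul E) ls_one.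
Definition ls_sum (s : seq (ls n r)) : ls n r := foldr ls_add ls_zero s.
Definition ls_prod (s : seq (ls n r)) : ls n r := foldr ls_mul ls_one s.
Definition ls_divu (j : 'I_r) E : ls n r :=
  LS (fun al => (lsh E al).+1)
     (fun al de => if [forall i, (i != j) ==> (0 < de i)%N]
                   then lco E al (fun i => if i == j then de i else (de i).-1)
                   else 0).
(* 1/(1+h), for h with no x^0 part:  sum_k (-h)^k  (x-adically convergent) *)
Definition ls_geominv (h : ls n r) : ls n r :=
  let S := fun K => ls_sum [seq ls_exp (ls_opp h) k | k <- iota 0 K.+1] in
  LS (fun al => lsh (S (mdeg al)) al) (fun al => lco (S (mdeg al)) al).
Definition ls_coef_neg E al (lam : 'I_r -> nat) : R :=
  if [forall i, (lam i <= lsh E al)%N]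
  then lco E al (fun i => lsh E al - lam i)%N else 0.
End LS.

Section KL.
Variable a : nat -> nat -> R.
Variable n : nat.
Variable lam : seq nat.
Local Notation r := (size lam).
Local Notation V := ('I_r + 'I_n)%type.

Definition uvar (i : 'I_r) : ps V := ps_var (inl i : V).
Definition xvar (j : 'I_n) : ps V := ps_var (inr j : V).

(* u_i / (u_i +_L \bar x_j), expanded in powers of x_j:
   u_i +_L \bar x_j = u_i (1 + h) with h = (u_i +_L \bar x_j - u_i)/u_i *)
Definition frac_ux (i : 'I_r) (j : 'I_n) : ls n r :=
  ls_geominv (ls_divu i (ls_of_ps (n:=n)
     (ps_add (fgl_eval a (uvar i) (ps_bar a (xvar j))) (ps_opp (uvar i))))).
Definition invP_u (i : 'I_r) : ls n r := ls_of_ps (n:=n) (ps_comp1 (invP_coef a) (uvar i)).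
Definition frac_uu (i j : 'I_r) : ls n r :=
  ls_divu j (ls_of_ps (n:=n) (fgl_eval a (uvar j) (ps_bar a (uvar i)))).

Definition KL_genfun : ls n r :=
  ls_prod ([seq invP_u i | i <- enum 'I_r]
        ++ [seq frac_ux p.1 p.2 | p <- enum [set: 'I_r * 'I_n]]
        ++ [seq frac_uu p.1 p.2 | p <- filter (fun p : 'I_r * 'I_r => (nat_of_ord p.1 < nat_of_ord p.2)%N) (enum [set: 'I_r * 'I_r])]).

Definition KL_coeff_series : ps 'I_n :=
  fun al => ls_coef_neg KL_genfun al (fun i : 'I_r => nth 0%N lam i).

Definition fgl_xx (p q : 'I_n) : ps 'I_n := fgl_eval a (ps_var p) (ps_bar a (ps_var q)).
Definition offdiag : seq ('I_n * 'I_n) := [seq p <- enum [set: 'I_n * 'I_n] | p.1 != p.2].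
(* D = prod_{p <> q} (x_p +_L \bar x_q) : the common denominator *)
Definition KL_den : ps 'I_n := ps_prod [seq fgl_xx p.1 p.2 | p <- offdiag].
(* coset representative of S_n/(S_1)^r x S_{n-r} <-> injection s : [r] -> [n]
   (s i = w(i+1)).  Denominator pairs of w.[...]: (w(i), w(j)), i <= r, j > i,
   i.e. (s i, q) with q not among s 0, ..., s i. *)
Definition den_pair (s : {ffun 'I_r -> 'I_n}) (p q : 'I_n) : bool :=
  [exists i : 'I_r, (s i == p) && [forall k : 'I_r, (k <= i)%N ==> (s k != q)]].
(* D * w.[ prod_i x_{w i}^{lam_i - i + n} / prod (x_{w i} +_L \bar x_{w j}) ] *)
Definition KL_term_num (s : {ffun 'I_r -> 'I_n}) : ps 'I_n :=
  ps_mul (ps_prod [seq ps_exp (ps_var (s i)) (nth 0%N lam i + n - i.+1)%N | i <- enum 'I_r])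
         (ps_prod [seq fgl_xx p.1 p.2 | p <- [seq p <- offdiag | ~~ den_pair s p.1 p.2]]).
Definition KL_sym_num : ps 'I_n :=
  fun m => \sum_(s : {ffun 'I_r -> 'I_n} | injectiveb s) KL_term_num s m.

(* f equals s^{L,KL}_lam(x_1..x_n) = sum_w w.[...] (an identity in the
   localization of R[[x]] at D, D a non-zero-divisor): f * D = sum_w D * w.[...] *)
Definition is_KL_schur (f : ps 'I_n) : Prop :=
  forall m : 'I_n -> nat, ps_mul f KL_den m = KL_sym_num m.

End KL.
End Series.

Definition is_partition (lam : seq nat) : bool :=
  sorted geq lam && all (fun k => 0 < k)%N lam.

Arguments KL_coeff_series {R} a n lam _.
Arguments is_KL_schur {R} a n lam f.

(* Main.v *)
(* The coefficient of u^-lambda is the iterated residue in u, expanded for |x| < |u|, of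
     prod_i u_i^(lambda_i + n - i) / P(u_i) * prod_(i < j) F(u_j, bar u_i)
       / prod_(i, j) F(u_i, bar x_j).
   Since F(u, bar x) = (u - x) gamma(u, x) with P(x) gamma(x, x) = 1, the residue in each u_i
   is a sum over the poles u_i = x_p, and the residue of 1/(P(u) F(u, bar x_p)) there is 1.
   The terms in which two variables sit at the same pole vanish because F(x, bar x) = 0, and
   in the others prod_(i < j) F(u_j, bar u_i) cancels the factors of the denominator that do
   not occur in the corresponding summand of the symmetrized fraction.  Over an arbitrary
   ring the sum over poles is obtained from Lagrange interpolation modulo prod_j (u_i - x_j),
   with denominators cleared, and the non-zero-divisors x_p - x_q are cancelled at the end. *)
Require Import Defs.
From HB Require Import structures.
From mathcomp Require Import all_boot all_order all_algebra.
From mathcomp Require Import boolp ring zify.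
Set Implicit Arguments. Unset Strict Implicit. Unset Printing Implicit Defensive.
Import GRing.Theory Num.Theory Order.TTheory.
Local Open Scope ring_scope.

(** * The ring of formal power series *)

(** The record [ls] is not a ring: a Laurent series has several encodings, with different shifts.
    The proof therefore does not compute in it. Up to a fixed shift, the u-exponents at x^al of
    every series involved are at least -|al|, so the change of variables x_j = y_j u_1 ... u_r turns
    these series into ordinary power series in u and y. They form a commutative ring in which
    x_j/u_i is a monomial, and a coefficient in u becomes a coefficient at a diagonal exponent.
    Using the product of all u_i treats them symmetrically, with no iterated Laurent expansion. The
    exponent lambda_i + n - i arises as follows: the coefficient of u_i^(-lambda_i) is the residue
    after multiplication by u_i^(lambda_i - 1), the fractions u_i/F(u_i, bar x_j) contribute u_i^n,
    and the i - 1 denominators u_i of the last product contribute u_i^(1 - i). *)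

Notation box V N := {ffun V -> 'I_N.+1}.
Notation bval b := (fun v => nat_of_ord (b v)).

Section Boxes.
Variable V : finType.
Implicit Types (b c m : V -> nat) (N : nat).

Definition eqm b c := [forall v, b v == c v].
Definition mle b c := [forall v, (b v <= c v)%N].
Definition addm b c : V -> nat := fun v => (b v + c v)%N.
Definition subm b c : V -> nat := fun v => (b v - c v)%N.
Definition zerom : V -> nat := fun=> 0%N.
Definition delta (w : V) : V -> nat := fun v => nat_of_bool (v == w).
Definition boxof N m : box V N := [ffun v => inord (m v)].

Lemma eqmP b c : reflect (b = c) (eqm b c).
Proof.
by apply: (iffP forallP) => [h|-> //]; apply: funext => v; apply/eqP.
Qed.

Lemma eqm_sym b c : eqm b c = eqm c b.
Proof. by apply/eqmP/eqmP. Qed.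

Lemma mleP b c : reflect (forall v, (b v <= c v)%N) (mle b c).
Proof. exact: forallP. Qed.

Lemma mle_addr b c : mle b (addm b c).
Proof. by apply/mleP => v; apply: leq_addr. Qed.

Lemma submK b c : mle b c -> addm b (subm c b) = c.
Proof. by move/mleP => h; apply: funext => v; rewrite /addm /subm subnKC. Qed.

Lemma addmK b c : subm (addm b c) b = c.
Proof. by apply: funext => v; rewrite /addm /subm addKn. Qed.

Lemma addmC b c : addm b c = addm c b.
Proof. by apply: funext => v; apply: addnC. Qed.

Lemma addmA b c m : addm b (addm c m) = addm (addm b c) m.
Proof. by apply: funext => v; apply: addnA. Qed.

Lemma addm0 b : addm b zerom = b.
Proof. by apply: funext => v; apply: addn0. Qed.

Lemma add0m b : addm zerom b = b.
Proof. by []. Qed.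

Lemma addm_inj b : injective (addm b).
Proof. by move=> c d h; rewrite -(addmK b c) h addmK. Qed.

Lemma mdegD b c : mdeg (addm b c) = (mdeg b + mdeg c)%N.
Proof. exact: big_split. Qed.

Lemma mdeg0 : mdeg zerom = 0%N.
Proof. exact: big1. Qed.

Lemma mdeg_ge b v : (b v <= mdeg b)%N.
Proof. by rewrite /mdeg (bigD1 v) //= leq_addr. Qed.

Lemma mdeg_delta w : mdeg (delta w) = 1%N.
Proof.
rewrite /mdeg (bigD1 w) //= {1}/delta eqxx big1 // => v.
by rewrite /delta => /negbTE ->.
Qed.

Lemma mdeg_eq0 b : mdeg b = 0%N -> b = zerom.
Proof.
by move=> h; apply: funext => v; have := mdeg_ge b v; rewrite h leqn0 => /eqP.
Qed.

Lemma boxofK N m : (forall v, (m v <= N)%N) -> bval (boxof N m) = m.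
Proof. by move=> h; apply: funext => v; rewrite ffunE inordK // ltnS. Qed.

Lemma bvalK N (b : box V N) : boxof N (bval b) = b.
Proof. by apply/ffunP => v; rewrite ffunE inord_val. Qed.

Lemma bval_le N (b : box V N) v : (b v <= N)%N.
Proof. by rewrite -ltnS. Qed.

Lemma mdeg_box N (b : box V N) : (mdeg (bval b) <= #|V| * N)%N.
Proof.
rewrite -sum_nat_const; apply: leq_sum => v _; exact: bval_le.
Qed.

Section BoxSum.
Variable T : nmodType.
Implicit Type F : (V -> nat) -> T.

(** The boxes bounding the exponents depend on the coefficient considered; enlarging them makes sums
    over different boxes comparable. *)
Lemma box_widen N N' F : (N <= N')%N ->
    (forall m, ~~ [forall v, (m v <= N)%N] -> F m = 0) ->
  \sum_(b : box V N') F (bval b) = \sum_(b : box V N) F (bval b).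
Proof.
move=> leN F0.
rewrite (bigID (fun b : box V N' => [forall v, (b v <= N)%N])) /=.
rewrite [X in _ + X]big1 ?addr0; last by move=> b h; apply: F0.
rewrite (reindex_onto (fun b : box V N => boxof N' (bval b))
                      (fun b : box V N' => boxof N (bval b))) /=.
  have E (b : box V N) : bval (boxof N' (bval b)) = bval b.
    by apply: boxofK => v; apply: leq_trans leN; apply: bval_le.
  apply: eq_big => [b|b _]; rewrite (E b) ?bvalK ?eqxx ?andbT //.
  by apply/forallP => v; rewrite (congr1 (@^~ v) (E b)); apply: bval_le.
by move=> b /forallP h; rewrite boxofK // bvalK.
Qed.

Lemma box_pick N F m : (forall v, (m v <= N)%N) ->
  \sum_(b : box V N) (if eqm (bval b) m then F (bval b) else 0) = F m.
Proof.
move=> h; rewrite (bigD1 (boxof N m)) //= boxofK // big1 => [|b bN].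
  by rewrite addr0; case: eqmP.
by case: eqmP => // E; rewrite -(bvalK b) E eqxx in bN.
Qed.

Lemma box_pick0 N F m : ~~ [forall v, (m v <= N)%N] ->
  \sum_(b : box V N) (if eqm (bval b) m then F (bval b) else 0) = 0.
Proof.
move=> h; rewrite big1 // => b _; case: eqmP => // E; move: h.
by rewrite -E => /forallP[] v; apply: bval_le.
Qed.

End BoxSum.
End Boxes.

Section PsRing.
Variables (R : comNzRingType) (V : finType).
Implicit Types (f g h : ps R V) (b c m : V -> nat).

(** A double sum over a box independent of m treats both factors alike, which reduces the ring
    axioms to exchanges of sums. *)
Lemma ps_mul_box N f g m : (forall v, (m v <= N)%N) ->
  ps_mul f g m = \sum_(b : box V N) \sum_(c : box V N)
    (if eqm (addm (bval b) (bval c)) m then f (bval b) * g (bval c) else 0).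
Proof.
move=> hN; rewrite /ps_mul.
pose G b := if mle b m then f b * g (subm m b) else 0.
rewrite big_mkcond /= -/(mle _ m).
have G0 M b : (forall v, (m v <= M)%N) -> ~~ [forall v, (b v <= M)%N] ->
    G b = 0.
  move=> hM; rewrite /G; case: mleP => // hb /forallP[] v.
  exact: leq_trans (hb v) (hM v).
have -> : \sum_(b : box V (mdeg m)) G (bval b) = \sum_(b : box V N) G (bval b).
  pose M := maxn N (mdeg m).
  rewrite -(@box_widen _ _ _ M) ?leq_maxr //; last first.
    by move=> b; apply: G0 => v; apply: mdeg_ge.
  by rewrite (@box_widen _ _ N) ?leq_maxl // => b; apply: G0.
apply: eq_bigr => b _; rewrite /G.
case: mleP => [/mleP hb|hb].
  rewrite -[RHS](@eq_bigr _ _ _ _ _ _ (fun c : box V N =>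
    if eqm (bval c) (subm m (bval b)) then f (bval b) * g (bval c) else 0)).
    rewrite (box_pick (fun c => f (bval b) * g c)) // => v.
    exact: leq_trans (leq_subr _ _) (hN v).
  move=> c _; case: eqmP => [->|nE]; first by rewrite submK //; case: eqmP.
  by case: eqmP => // E; case: nE; rewrite -E addmK.
rewrite big1 // => c _; case: eqmP => // E; case: hb; rewrite -E => v.
exact: leq_addr.
Qed.

HB.instance Definition _ := gen_eqMixin (ps R V).
HB.instance Definition _ := gen_choiceMixin (ps R V).

Fact ps_addA : associative (@ps_add R V).
Proof. by move=> f g h; apply: funext => m; apply: addrA. Qed.
Fact ps_addC : commutative (@ps_add R V).
Proof. by move=> f g; apply: funext => m; apply: addrC. Qed.
Fact ps_add0 : left_id (@ps_zero R V) (@ps_add R V).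
Proof. by move=> f; apply: funext => m; apply: add0r. Qed.
Fact ps_addN : left_inverse (@ps_zero R V) (@ps_opp R V) (@ps_add R V).
Proof. by move=> f; apply: funext => m; apply: addNr. Qed.
HB.instance Definition _ :=
  GRing.isZmodule.Build (ps R V) ps_addA ps_addC ps_add0 ps_addN.

Fact ps_mulC : commutative (@ps_mul R V).
Proof.
move=> f g; apply: funext => m.
rewrite !(@ps_mul_box (mdeg m)) => [|v|v]; try exact: mdeg_ge.
rewrite exchange_big; apply: eq_bigr => b _; apply: eq_bigr => c _.
by rewrite addmC mulrC.
Qed.

Lemma ps_mul3_box N f g h m : (forall v, (m v <= N)%N) ->
  ps_mul (ps_mul f g) h m =
  \sum_(b : box V N) \sum_(c : box V N) \sum_(d : box V N)
    (if eqm (addm (addm (bval b) (bval c)) (bval d)) m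
     then f (bval b) * g (bval c) * h (bval d) else 0).
Proof.
move=> hN; rewrite (ps_mul_box _ _ hN).
under eq_bigr => e _ do under eq_bigr => d _ do
  rewrite (ps_mul_box f g (bval_le e)).
rewrite exchange_big /=.
under eq_bigr => d _ do under eq_bigr => e _ do rewrite big_distrl /=.
(* The exponent e of the inner product becomes a summation variable tied to b + c, so that it can be
   summed out last. *)
transitivity (\sum_(d : box V N) \sum_(b : box V N) \sum_(c : box V N)
  \sum_(e : box V N) (if eqm (bval e) (addm (bval b) (bval c)) then
     (if eqm (addm (bval e) (bval d)) m
     then f (bval b) * g (bval c) * h (bval d) else 0) else 0)).
  apply: eq_bigr => d _.
  under [RHS]eq_bigr => b _ do rewrite exchange_big /=.
  rewrite [RHS]exchange_big /=; apply: eq_bigr => e _.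
  case: ifP => E; last first.
    by symmetry; apply: big1 => b _; apply: big1 => c _; case: ifP.
  apply: eq_bigr => b _; rewrite big_distrl; apply: eq_bigr => c _ /=.
  by rewrite eqm_sym; case: ifP; rewrite ?mul0r.
rewrite exchange_big; apply: eq_bigr => b _.
rewrite exchange_big; apply: eq_bigr => c _; apply: eq_bigr => d _.
case: (boolP [forall v, (addm (bval b) (bval c) v <= N)%N]) => [/forallP|] H.
  exact: (box_pick (fun e => if eqm (addm e (bval d)) m then _ else 0)).
rewrite (box_pick0 (fun e => if eqm (addm e (bval d)) m then _ else 0)) //.
case: eqmP => // E; case/forallP: H => v; apply: leq_trans (hN v).
by rewrite -E; apply: leq_addr.
Qed.

Fact ps_mulA : associative (@ps_mul R V).
Proof.
move=> f g h; apply: funext => m; rewrite [ps_mul f _]ps_mulC.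
rewrite !(@ps_mul3_box (mdeg m)) => [|v|v]; try exact: mdeg_ge.
rewrite [RHS]exchange_big; apply: eq_bigr => c _.
rewrite [RHS]exchange_big; apply: eq_bigr => d _; apply: eq_bigr => b _ /=.
rewrite [addm (addm _ _) (bval b)]addmC addmA.
by rewrite [_ * f _]mulrC mulrA.
Qed.

Fact ps_mul1 : left_id (@ps_one R V) (@ps_mul R V).
Proof.
move=> f; apply: funext => m.
rewrite (@ps_mul_box (mdeg m)) => [|v]; try exact: mdeg_ge.
rewrite (bigD1 (boxof (mdeg m) (@zerom V))) //= [X in _ + X]big1 ?addr0.
  rewrite boxofK // -[RHS](box_pick f (@mdeg_ge _ m)); apply: eq_bigr => c _.
  rewrite add0m; case: ifP => // _; rewrite /ps_one.
  by case: forallP => [_|[]]; rewrite ?mul1r.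
move=> b nb; apply: big1 => c _; case: ifP => // _; rewrite /ps_one.
case: forallP => [E|_]; rewrite ?mul0r //; case/eqP: nb.
by apply/ffunP => v; apply: ord_inj; rewrite ffunE inordK //; apply/eqP.
Qed.

Fact ps_mulDl : left_distributive (@ps_mul R V) (@ps_add R V).
Proof.
move=> f g h; apply: funext => m; rewrite /ps_add /ps_mul -big_split /=.
by apply: eq_bigr => b _; apply: mulrDl.
Qed.

Fact ps_one_neq0 : @ps_one R V != @ps_zero R V.
Proof.
apply/eqP => /(congr1 (fun f : ps R V => f (@zerom V))).
rewrite /ps_one /ps_zero; case: forallP => [_|[]] //.
by apply/eqP; apply: oner_neq0.
Qed.

HB.instance Definition _ := GRing.Zmodule_isComNzRing.Build (ps R V)
  ps_mulA ps_mulC ps_mul1 ps_mulDl ps_one_neq0.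

Lemma psDE f g m : (f + g) m = f m + g m. Proof. by []. Qed.
Lemma psNE f m : (- f) m = - f m. Proof. by []. Qed.
Lemma psBE f g m : (f - g) m = f m - g m. Proof. by []. Qed.
Lemma ps0E m : (0 : ps R V) m = 0. Proof. by []. Qed.
Lemma ps_sumE (I : Type) (s : seq I) (P : pred I) (F : I -> ps R V) m :
  (\sum_(i <- s | P i) F i) m = \sum_(i <- s | P i) F i m.
Proof. exact: (big_morph (fun f : ps R V => f m)). Qed.

Lemma psME N f g m : (forall v, (m v <= N)%N) ->
  (f * g) m = \sum_(b : box V N) \sum_(c : box V N)
    (if eqm (addm (bval b) (bval c)) m then f (bval b) * g (bval c) else 0).
Proof. exact: ps_mul_box. Qed.

Lemma ps_expE f k : ps_exp f k = f ^+ k.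
Proof. by elim: k => [|k IH] //=; rewrite exprS -IH. Qed.

Lemma ps_prodE (s : seq (ps R V)) : ps_prod s = \prod_(f <- s) f.
Proof. by elim: s => [|f s IH] /=; rewrite ?big_nil ?big_cons -?IH. Qed.

Definition mono m : ps R V := fun m' => if eqm m' m then 1 else 0.

Lemma mono0 : mono (@zerom V) = 1. Proof. by []. Qed.

Lemma ps_varE w : ps_var R w = mono (delta w). Proof. by []. Qed.

Lemma psM_neq0 f g m : (f * g) m <> 0 ->
  exists b c, [/\ addm b c = m, f b <> 0 & g c <> 0].
Proof.
rewrite (psME _ _ (@mdeg_ge _ m)) => h; apply: contrapT => H; apply: h.
apply: big1 => b _; apply: big1 => c _; case: eqmP => // E.
apply: contrapT => nz; apply: H; exists (bval b), (bval c); split=> // Z.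
  by apply: nz; rewrite Z mul0r.
by apply: nz; rewrite Z mulr0.
Qed.

Lemma monoME m f m' :
  (mono m * f) m' = if mle m m' then f (subm m' m) else 0.
Proof.
rewrite (psME _ _ (@mdeg_ge _ m')).
under eq_bigr => b _.
  under eq_bigr => c _ do rewrite -[X in if _ then X else _]/(mono m (bval b) * f (bval c)).
  rewrite (_ : \sum_c _ = if eqm (bval b) m then
    \sum_(c : box V (mdeg m')) (if eqm (addm (bval b) (bval c)) m' then f (bval c) else 0)
    else 0); last first.
    rewrite /mono; case: ifP => _.
      by apply: eq_bigr => c _; rewrite mul1r.
    by apply: big1 => c _; rewrite mul0r; case: ifP.
  over.
case: ifP => [H|H].
  rewrite (box_pick (fun b => \sum_(c : box V (mdeg m')) (if eqm (addm b (bval c)) m' then f (bval c) else 0))); last first.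
    by move=> v; apply: leq_trans (mdeg_ge m' v); apply/mleP.
  rewrite -[RHS](box_pick f (N := mdeg m')); last first.
    by move=> v; apply: leq_trans (leq_subr _ _) (mdeg_ge m' v).
  apply: eq_bigr => c _; case: eqmP => [E|nE].
    by case: eqmP => // [[]]; rewrite -[LHS](addmK m) E.
  by case: eqmP => // E; case: nE; rewrite E submK.
apply: big1 => b _; case: eqmP => // E; apply: big1 => c _.
case: eqmP => // E2; case/negP: (negbT H); have := mle_addr (bval b) (bval c).
by rewrite E2 E.
Qed.

Lemma monoMD m f m' : (mono m * f) (addm m m') = f m'.
Proof. by rewrite monoME mle_addr addmK. Qed.

Lemma monoM b c : mono b * mono c = mono (addm b c).
Proof.
apply: funext => m; rewrite monoME; case: (boolP (mle b m)) => H.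
  rewrite /mono -{2}(submK H); case: eqmP => [->|nE]; first by case: eqmP.
  by case: eqmP => // /addm_inj.
by rewrite /mono; case: eqmP => // E; rewrite E mle_addr in H.
Qed.

Lemma monoX b k : mono b ^+ k = mono (fun v => k * b v)%N.
Proof.
elim: k => [|k IH]; first by rewrite expr0 -mono0.
by rewrite exprS IH monoM; congr mono; apply: funext => v; rewrite /addm mulSn.
Qed.

Lemma mono_prod (I : Type) (s : seq I) (P : pred I) (F : I -> V -> nat) :
  \prod_(i <- s | P i) mono (F i) = mono (fun v => \sum_(i <- s | P i) F i v)%N.
Proof.
elim: s => [|i s IH].
  by rewrite big_nil -mono0; congr mono; apply: funext => v; rewrite big_nil.
rewrite big_cons IH; case: ifP => Pi; [rewrite monoM|]; congr mono;
  by apply: funext => v; rewrite big_cons Pi.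
Qed.

Lemma mono_lreg m : GRing.lreg (mono m).
Proof.
by move=> f g h; apply: funext => m'; rewrite -(monoMD m f) -(monoMD m g) h.
Qed.

Definition psC (x : R) : ps R V := fun m => if eqm m (@zerom V) then x else 0.

Lemma psCME x f m : (psC x * f) m = x * f m.
Proof.
have -> : psC x * f = (fun m => x * f m); last by [].
have -> : (fun m => x * f m) = ((fun m' => x * (mono (@zerom V) m')) : ps R V) * f.
  rewrite -[in LHS](mul1r f) -mono0; apply: funext => m'.
  rewrite !(psME _ _ (@mdeg_ge _ m')) big_distrr; apply: eq_bigr => b _.
  rewrite big_distrr; apply: eq_bigr => d _ /=.
  by case: ifP; rewrite ?mulr0 ?mulrA.
congr (_ * _); apply: funext => m'; rewrite /psC /mono.
by case: ifP; rewrite ?mulr1 ?mulr0.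
Qed.

End PsRing.

(** * Weights, geometric series and substitution *)

Section Weights.
Variables (R : comNzRingType) (V : finType).
Implicit Types (f g h : ps R V) (b c m : V -> nat) (w : V -> int).

(** Negative weights are allowed because the gradings [uwt] below give y_j the weight -1. *)
Definition wt w m : int := \sum_v w v *+ m v.
Definition wge w (d : int) f := forall m, wt w m < d -> f m = 0.

Lemma wtD w b c : wt w (addm b c) = wt w b + wt w c.
Proof. by rewrite /wt -big_split; apply: eq_bigr => v _; apply: mulrnDr. Qed.

Lemma wt0 w : wt w (@zerom V) = 0.
Proof. exact: big1. Qed.

Lemma wt1 m : wt (fun=> 1) m = (mdeg m)%:Z.
Proof. by rewrite /wt /mdeg -natz natr_sum. Qed.

Lemma wgeM w d e f g : wge w d f -> wge w e g -> wge w (d + e) (f * g).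
Proof.
move=> hf hg m hm; apply: contrapT => /psM_neq0[b [c [E fb gc]]].
have hb : d <= wt w b by rewrite leNgt; apply/negP => /hf.
have hc : e <= wt w c by rewrite leNgt; apply/negP => /hg.
by move: hm; rewrite -E wtD ltNge lerD.
Qed.

Lemma wgeN w d f : wge w d f -> wge w d (- f).
Proof. by move=> hf m hm; rewrite psNE hf ?oppr0. Qed.

Lemma wge_mono w d b : d <= wt w b -> wge w d (mono R b).
Proof.
by move=> h m; rewrite /mono; case: eqmP => // ->; rewrite ltNge h.
Qed.

Lemma wge1 w : wge w 0 (1 : ps R V).
Proof. by rewrite -mono0; apply: wge_mono; rewrite wt0. Qed.

Lemma wgeX w d f k : wge w d f -> wge w (d *+ k) (f ^+ k).
Proof.
move=> hf; elim: k => [|k IH]; first by rewrite expr0 mulr0n; apply: wge1.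
by rewrite exprS mulrS; apply: wgeM.
Qed.

Lemma wge_prod (I : Type) (s : seq I) (P : pred I) w (F : I -> ps R V) :
  (forall i, P i -> wge w 0 (F i)) -> wge w 0 (\prod_(i <- s | P i) F i).
Proof.
move=> h; apply: (big_ind (wge w 0)) => //; first exact: wge1.
by move=> f g hf hg; rewrite -[0]addr0; apply: wgeM.
Qed.

Definition ordge N f := forall m, (mdeg m < N)%N -> f m = 0.

Lemma ordgeE N f : ordge N f <-> wge (fun=> 1) N%:Z f.
Proof.
by split=> h m hm; apply: h; move: hm; rewrite wt1 ltz_nat.
Qed.

Lemma ordgeM M N f g : ordge M f -> ordge N g -> ordge (M + N) (f * g).
Proof. by move=> /ordgeE hf /ordgeE hg; apply/ordgeE; rewrite PoszD; apply: wgeM. Qed.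

Lemma ordgeX M f k : ordge M f -> ordge (M * k) (f ^+ k).
Proof.
move=> h; elim: k => [|k IH]; first by rewrite muln0.
by rewrite exprS mulnS; apply: ordgeM.
Qed.

Lemma ordgeD N f g : ordge N f -> ordge N g -> ordge N (f + g).
Proof. by move=> hf hg m hm; rewrite psDE hf ?hg ?addr0. Qed.

Lemma ordgeN N f : ordge N f -> ordge N (- f).
Proof. by move=> hf m hm; rewrite psNE hf ?oppr0. Qed.

Lemma ordgeMl N f g : ordge N g -> ordge N (f * g).
Proof. by move=> h; apply: (ordgeM (M := 0)). Qed.

Lemma ordge1_coef f : f (@zerom V) = 0 -> ordge 1 f.
Proof. by move=> h m; rewrite ltnS leqn0 => /eqP/mdeg_eq0 ->. Qed.

Lemma ordge_var (v : V) : ordge 1 (ps_var R v).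
Proof.
apply: ordge1_coef; rewrite ps_varE /mono; case: eqmP => // /(congr1 (@^~ v)).
by rewrite /zerom /delta eqxx.
Qed.

Lemma addm_mdeg b c m : addm b c = m -> (mdeg b <= mdeg m)%N /\ (mdeg c <= mdeg m)%N.
Proof. by move=> <-; rewrite mdegD leq_addr leq_addl. Qed.

Definition eqd N f g := forall m, (mdeg m <= N)%N -> f m = g m.

Lemma eqd_refl N f : eqd N f f. Proof. by []. Qed.

Lemma eqdM N f f' g g' : eqd N f f' -> eqd N g g' -> eqd N (f * g) (f' * g').
Proof.
move=> hf hg m hm; rewrite !(psME _ _ (@mdeg_ge _ m)).
apply: eq_bigr => b _; apply: eq_bigr => c _; case: eqmP => // E.
have [hb hc] := addm_mdeg E.
by rewrite hf ?hg //; apply: leq_trans hm.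
Qed.

Lemma eqdX N f f' k : eqd N f f' -> eqd N (f ^+ k) (f' ^+ k).
Proof. by move=> h; elim: k => [|k IH] //; rewrite !exprS; apply: eqdM. Qed.

Lemma ps_coef0M f g : (f * g) (@zerom V) = f (@zerom V) * g (@zerom V).
Proof.
have h (v : V) : (@zerom V v <= 0)%N by [].
rewrite (psME _ _ h) (bigD1 [ffun=> ord0]) //= (bigD1 [ffun=> ord0]) //=.
have E0 : bval ([ffun=> ord0] : box V 0) = @zerom V.
  by apply: funext => v; rewrite ffunE.
rewrite E0 big1 => [|c nc]; last first.
  by case/eqP: nc; apply/ffunP => v; rewrite ffunE; apply: ord1.
rewrite big1 => [|c nc]; last first.
  by case/eqP: nc; apply/ffunP => v; rewrite ffunE; apply: ord1.
by case: eqmP => //; rewrite !addr0.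
Qed.

(** The inverse of 1 + h when h has zero constant term: h^k then has order at least k, so the
    truncation loses nothing. *)
Definition geo h : ps R V := fun m => (\sum_(k < (mdeg m).+1) (- h) ^+ k) m.

Lemma geo_trunc h N : ordge 1 h -> eqd N (geo h) (\sum_(k < N.+1) (- h) ^+ k).
Proof.
move=> hh m hm; rewrite /geo !ps_sumE -!(big_mkord xpredT (fun k => ((- h) ^+ k) m)).
rewrite [RHS](big_cat_nat (n := (mdeg m).+1)) //=.
rewrite [X in _ + X]big_nat_cond [X in _ + X]big1 ?addr0 // => k.
rewrite andbT => /andP[hk _].
by apply: (ordgeX (k := k) (ordgeN hh)); rewrite mul1n.
Qed.

Lemma geoP h : ordge 1 h -> (1 + h) * geo h = 1.
Proof.
move=> hh; apply: funext => m.
rewrite (eqdM (eqd_refl _) (geo_trunc (N := mdeg m) hh)) //.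
have -> : (1 + h) * (\sum_(k < (mdeg m).+1) (- h) ^+ k) = 1 - (- h) ^+ (mdeg m).+1.
  by rewrite -[RHS]opprB subrX1; ring.
by rewrite psBE (ordgeX (k := (mdeg m).+1) (ordgeN hh)) ?subr0 // mul1n.
Qed.

Lemma ps_unit_ex f : f (@zerom V) = 1 -> exists f', f * f' = 1.
Proof.
move=> h; exists (geo (f - 1)).
rewrite -[X in X * _](addrNK 1) [X in X * _]addrC; apply: geoP.
apply: ordge1_coef; rewrite psBE h.
by rewrite -mono0 /mono; case: eqmP => //; rewrite subrr.
Qed.

Lemma wge_geo w h : wge w 0 h -> wge w 0 (geo h).
Proof.
move=> hh m hm; rewrite /geo ps_sumE big1 // => k _.
by have := wgeX (k := k) (wgeN hh); rewrite mul0rn; apply.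
Qed.

End Weights.

Lemma lreg_unitl (R : comNzRingType) (x y : R) : x * y = 1 -> GRing.lreg x.
Proof. by move=> h a b /(congr1 ( *%R y)); rewrite !mulrA [y * x]mulrC h !mul1r. Qed.

Lemma inv_uniq (R : comNzRingType) (x y z : R) : x * y = 1 -> x * z = 1 -> y = z.
Proof. by move=> h h'; apply: (lreg_unitl h); rewrite h h'. Qed.

(** * Substitution of power series without constant term *)

Section Subst.
Variable R : comNzRingType.

Section Def.
Variables (V W : finType) (g : V -> ps R W).

Definition mprod (b : V -> nat) : ps R W := \prod_v g v ^+ b v.

(* Sum over b of f_b g^b; when every g v has zero constant term, g^b has order at
   least |b|, so the exponents bounded by |m| suffice for the coefficient at m. *)
Definition subst (f : ps R V) : ps R W := fun m =>
  \sum_(b : box V (mdeg m)) f (bval b) * mprod (bval b) m.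

Lemma mprodD b c : mprod (addm b c) = mprod b * mprod c.
Proof. by rewrite /mprod -big_split; apply: eq_bigr => v _; apply: exprD. Qed.

Lemma mprod0 : mprod (@zerom V) = 1.
Proof. by rewrite /mprod big1. Qed.

Lemma mprod_delta v : mprod (delta v) = g v.
Proof.
rewrite /mprod (bigD1 v) //= {1}/delta eqxx expr1 big1 ?mulr1 // => u.
by rewrite /delta => /negbTE ->.
Qed.

Lemma substD f f' : subst (f + f') = subst f + subst f'.
Proof.
apply: funext => m; rewrite /subst psDE -big_split.
by apply: eq_bigr => b _; rewrite psDE mulrDl.
Qed.

Lemma substN f : subst (- f) = - subst f.
Proof.
apply: funext => m; rewrite /subst psNE -sumrN.
by apply: eq_bigr => b _; rewrite psNE mulNr.
Qed.

Lemma substB f f' : subst (f - f') = subst f - subst f'.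
Proof. by rewrite substD substN. Qed.

Lemma subst0 : subst 0 = 0.
Proof. by apply: funext => m; rewrite /subst big1 // => b _; rewrite ps0E mul0r. Qed.

Lemma subst_sum (I : Type) (s : seq I) (P : pred I) (F : I -> ps R V) :
  subst (\sum_(i <- s | P i) F i) = \sum_(i <- s | P i) subst (F i).
Proof. exact: (big_morph subst substD subst0). Qed.

Hypothesis hg : forall v, ordge 1 (g v).

Lemma mprod_ord b : ordge (mdeg b) (mprod b).
Proof.
rewrite /mprod /mdeg; elim: (index_enum V) => [|v s IH].
  by rewrite !big_nil.
rewrite !big_cons; apply: ordgeM => //.
by have := ordgeX (k := b v) (hg v); rewrite mul1n.
Qed.

Lemma substE N f m : (mdeg m <= N)%N ->
  subst f m = \sum_(b : box V N) f (bval b) * mprod (bval b) m.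
Proof.
move=> hN; symmetry.
apply: (@box_widen _ _ _ N (fun b => f b * mprod b m) hN) => b /forallPn[v].
rewrite -ltnNge => hv; rewrite (@mprod_ord b) ?mulr0 //.
exact: leq_trans hv (mdeg_ge b v).
Qed.

Lemma subst1 : subst 1 = 1.
Proof.
apply: funext => m; rewrite /subst -mono0.
transitivity (mprod (@zerom V) m); last by rewrite mprod0 -mono0.
rewrite -[RHS](@box_pick _ _ (mdeg m) (fun b => mprod b m) (@zerom V)) //.
by apply: eq_bigr => b _; rewrite /mono; case: ifP; rewrite ?mul1r ?mul0r.
Qed.

Lemma substM f f' : subst (f * f') = subst f * subst f'.
Proof.
apply: funext => m; set N := mdeg m; rewrite /subst.
have h1 : (subst f * subst f') m = \sum_(c : box V N) \sum_(d : box V N)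
    f (bval c) * f' (bval d) * (mprod (bval c) * mprod (bval d)) m.
  rewrite (psME _ _ (@mdeg_ge _ m)).
  transitivity (\sum_(b : box W N) \sum_(b' : box W N) \sum_(c : box V N) \sum_(d : box V N)
     f (bval c) * f' (bval d) * (if eqm (addm (bval b) (bval b')) m then
       mprod (bval c) (bval b) * mprod (bval d) (bval b') else 0)).
    apply: eq_bigr => b _; apply: eq_bigr => b' _; case: eqmP => E; last first.
      by rewrite big1 // => c _; rewrite big1 // => d _; rewrite mulr0.
    have [hb hb'] := addm_mdeg E.
    rewrite (substE f hb) (substE f' hb') big_distrl.
    apply: eq_bigr => c _; rewrite big_distrr; apply: eq_bigr => d _ /=; ring.
  under eq_bigr => b _ do rewrite exchange_big.
  rewrite exchange_big; apply: eq_bigr => c _.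
  under eq_bigr => b _ do rewrite exchange_big.
  rewrite exchange_big; apply: eq_bigr => d _ /=.
  rewrite (psME _ _ (@mdeg_ge _ m)) big_distrr; apply: eq_bigr => b _.
  by rewrite big_distrr.
rewrite -[RHS]/((subst f * subst f') m) h1.
transitivity (\sum_(b : box V N) \sum_(c : box V N) \sum_(d : box V N)
   if eqm (bval b) (addm (bval c) (bval d))
   then f (bval c) * f' (bval d) * mprod (bval b) m else 0).
  apply: eq_bigr => b _; rewrite (psME _ _ (bval_le b)) big_distrl.
  apply: eq_bigr => c _; rewrite big_distrl; apply: eq_bigr => d _ /=.
  by rewrite eqm_sym; case: ifP; rewrite ?mul0r.
rewrite exchange_big; apply: eq_bigr => c _.
rewrite exchange_big; apply: eq_bigr => d _ /=.
case: (boolP [forall v, (addm (bval c) (bval d) v <= N)%N]) => [/forallP|] H.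
  by rewrite (box_pick (fun b => f (bval c) * f' (bval d) * mprod b m)) // mprodD.
(* Pairs with c + d outside the box are missing on one side; on the other their product has order
   greater than |m|. *)
rewrite (box_pick0 (fun b => f (bval c) * f' (bval d) * mprod b m)) //.
have /forallPn[v hv] := H; rewrite -mprodD (@mprod_ord (addm _ _)) ?mulr0 //.
by apply: leq_trans (mdeg_ge _ v); rewrite ltnNge.
Qed.

Lemma substX f k : subst (f ^+ k) = subst f ^+ k.
Proof. by elim: k => [|k IH]; rewrite ?expr0 ?subst1 // !exprS substM IH. Qed.

Lemma subst_prod (I : Type) (s : seq I) (P : pred I) (F : I -> ps R V) :
  subst (\prod_(i <- s | P i) F i) = \prod_(i <- s | P i) subst (F i).
Proof. exact: (big_morph subst substM subst1). Qed.

Lemma subst_mono b : subst (mono R b) = mprod b.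
Proof.
apply: funext => m; pose N := maxn (mdeg m) (mdeg b).
rewrite (@substE N) ?leq_maxl //.
rewrite -[RHS](@box_pick _ _ N (fun b => mprod b m) b) => [|v].
  by apply: eq_bigr => c _; rewrite /mono; case: ifP; rewrite ?mul1r ?mul0r.
by apply: leq_trans (mdeg_ge _ v) (leq_maxr _ _).
Qed.

Lemma subst_var v : subst (ps_var R v) = g v.
Proof. by rewrite ps_varE subst_mono mprod_delta. Qed.

Lemma subst_ord N f : ordge N f -> ordge N (subst f).
Proof.
move=> hf m hm; rewrite /subst big1 // => b _.
case: (ltnP (mdeg (bval b)) N) => hb; first by rewrite hf ?mul0r.
by rewrite mprod_ord ?mulr0 //; apply: leq_trans hb.
Qed.

Lemma subst_coef0 f : subst f (@zerom W) = f (@zerom V).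
Proof.
rewrite -{1}(subrK (psC (f (@zerom V)) : ps R V) f) substD psDE.
rewrite (@subst_ord 1) ?mdeg0 // ?add0r; last first.
  apply: ordge1_coef; rewrite psBE /psC; case: eqmP => // _; exact: subrr.
rewrite (@substE 0) ?mdeg0 // -[RHS](@box_pick _ _ 0 (fun=> f (@zerom V)) (@zerom V)) //.
apply: eq_bigr => b _; rewrite /psC; case: eqmP => [->|]; rewrite ?mul0r //.
by rewrite mprod0 -mono0 /mono; case: eqmP => // _; rewrite mulr1.
Qed.

End Def.

Lemma subst_fix (V : finType) (g : V -> ps R V) f :
  (forall b, f b <> 0 -> mprod g b = mono R b) -> (forall v, ordge 1 (g v)) ->
  subst g f = f.
Proof.
move=> h hg; apply: funext => m; rewrite /subst.
rewrite -[RHS](@box_pick _ _ (mdeg m) f m) => [|v]; last exact: mdeg_ge.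
apply: eq_bigr => b _; have [->|/eqP nz] := eqVneq (f (bval b)) 0.
  by rewrite mul0r if_same.
by rewrite h // /mono eqm_sym; case: ifP; rewrite ?mulr1 ?mulr0.
Qed.

Lemma subst_comp (V W X : finType) (g : V -> ps R W) (h : W -> ps R X) f :
    (forall v, ordge 1 (g v)) -> (forall v, ordge 1 (h v)) ->
  subst h (subst g f) = subst (fun v => subst h (g v)) f.
Proof.
move=> hg hh; have hgh v : ordge 1 (subst h (g v)) by apply: subst_ord.
apply: funext => m; set N := mdeg m; rewrite /subst -/N.
(* An exponent in the box of size N over W has degree at most [#|W| * N], and the inner substitution
   must be expanded up to that degree. *)
pose M := maxn N (#|W| * N).
rewrite -[RHS]/(subst (fun v => subst h (g v)) f m) (substE hgh (N := M)) ?leq_maxl //.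
transitivity (\sum_(b : box W N) \sum_(c : box V M)
   f (bval c) * mprod g (bval c) (bval b) * mprod h (bval b) m).
  apply: eq_bigr => b _; rewrite -[X in X * _]/(subst g f (bval b)).
  rewrite (substE hg (N := M)) ?big_distrl //.
  by apply: leq_trans (mdeg_box b) (leq_maxr _ _).
rewrite exchange_big; apply: eq_bigr => c _ /=.
have -> : mprod (fun v => subst h (g v)) (bval c) = subst h (mprod g (bval c)).
  by rewrite /mprod subst_prod //; apply: eq_bigr => v _; rewrite substX.
by rewrite /subst big_distrr; apply: eq_bigr => b _ /=; rewrite mulrA.
Qed.

Lemma eq_subst (V W : finType) (g g' : V -> ps R W) f : g =1 g' -> subst g f = subst g' f.
Proof. by move/funext => ->. Qed.

Lemma subst_vars (V : finType) f : subst (fun v : V => ps_var R v) f = f.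
Proof.
apply: subst_fix => [b _|v]; last exact: ordge_var.
rewrite /mprod; under eq_bigr => v _ do rewrite ps_varE monoX.
rewrite mono_prod; congr mono; apply: funext => v.
rewrite (bigD1 v) //= {1}/delta eqxx muln1 big1 ?addn0 // => u nu.
by rewrite /delta eq_sym (negbTE nu) muln0.
Qed.

End Subst.

(** * Formal group laws *)

Section Variables.
Variables (R : comNzRingType) (V : finType).
Implicit Types (f g h : ps R V) (m : V -> nat) (v w : V).

Lemma mle_delta v m : mle (delta v) m = (0 < m v)%N.
Proof.
apply/mleP/idP => [/(_ v)|h u]; rewrite /delta ?eqxx //.
by case: eqP => // ->.
Qed.

Lemma varME v f m :
  (ps_var R v * f) m = if (0 < m v)%N then f (subm m (delta v)) else 0.
Proof. by rewrite ps_varE monoME mle_delta. Qed.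

Lemma varMD v f m : (ps_var R v * f) (addm (delta v) m) = f m.
Proof. by rewrite ps_varE monoMD. Qed.

Lemma var_divE v f : (forall m, m v = 0%N -> f m = 0) ->
  f = ps_var R v * ((fun m => f (addm (delta v) m)) : ps R V).
Proof.
move=> h; apply: funext => m; rewrite varME; case: posnP => [/h //|mv].
by rewrite submK // mle_delta.
Qed.

Lemma var_lreg v : GRing.lreg (ps_var R v).
Proof. by rewrite ps_varE; apply: mono_lreg. Qed.

Lemma eqd_varM N v f g : eqd N f g -> eqd N.+1 (ps_var R v * f) (ps_var R v * g).
Proof.
move=> h m hm; rewrite !varME; case: ifP => // mv; apply: h.
have := mdegD (delta v) (subm m (delta v)).
by rewrite submK ?mle_delta // mdeg_delta => E; move: hm; rewrite E.
Qed.

(** If v f = w f, the coefficient of f at m equals the one at m with an exponent of w traded for one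
    of v; induction on the exponent of w ends at 0, for any coefficient ring. *)
Lemma sub_var_lreg v w : v != w -> GRing.lreg (ps_var R v - ps_var R w).
Proof.
move=> nvw; suff H f : (ps_var R v - ps_var R w) * f = 0 -> f = 0.
  by move=> f g /eqP; rewrite -subr_eq0 -mulrBr => /eqP/H/eqP; rewrite subr_eq0 => /eqP.
rewrite mulrBl => /eqP; rewrite subr_eq0 => /eqP E; apply: funext => m.
move En : (m w) => n; elim: n m En => [|n IH] m En.
  rewrite -(varMD v f) E varME {1}/addm En {1}/delta.
  by rewrite eq_sym (negbTE nvw).
rewrite -(varMD v f) E varME; case: ifP => // _; apply: IH.
by rewrite /subm /addm /delta eqxx eq_sym (negbTE nvw) En; lia.
Qed.

Definition ev (v w : V) (x : V) : ps R V := if x == v then ps_var R w else ps_var R x.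

Lemma ev_ord v w x : ordge 1 (ev v w x).
Proof. by rewrite /ev; case: ifP => _; apply: ordge_var. Qed.

Section Division.
Variables (v w : V) (f : ps R V).
Hypothesis nvw : v != w.
Let mv m i j : V -> nat := fun x => (m x + i * (x == v) - j * (x == w))%N.

(* Divided difference: (x^k - y^k)/(x - y) = sum_(i+j=k-1) x^i y^j, monomial by monomial. *)
Let q : ps R V := fun m => \sum_(b < (m w).+1) f (mv m b.+1 b).
Let T m := \sum_(b < m w) f (mv m b.+1 b.+1).
Let f0 : ps R V := fun m => if m v == 0%N then f m + T m else 0.

Lemma division_split : f = (ps_var R v - ps_var R w) * q + f0.
Proof.
apply: funext => m; rewrite psDE mulrBl psBE.
have -> : (ps_var R w * q) m = T m.
  rewrite varME /T; case: posnP => mw; first by rewrite mw big_ord0.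
  have Em : (subm m (delta w) w).+1 = m w by rewrite /subm /delta eqxx subn1 prednK.
  rewrite /q Em; apply: eq_bigr => b _.
  congr (f _); apply: funext => x; rewrite /mv /subm /delta.
  have [->|_] := eqVneq x w; lia.
have -> : (ps_var R v * q) m = if m v == 0%N then 0 else f m + T m.
  rewrite varME lt0n; case: eqP => //= mv0.
  have Em : subm m (delta v) w = m w.
    by rewrite /subm /delta eq_sym (negbTE nvw) subn0.
  rewrite /q Em.
  have mvE b c : mv (subm m (delta v)) b.+1 c = mv m b c.
    apply: funext => x; rewrite /mv /subm /delta; have [->|_] := eqVneq x v; lia.
  rewrite big_ord_recl /T mvE; congr (f _ + _).
    by apply: funext => x; rewrite /mv !mul0n addn0 subn0.
  by apply: eq_bigr => b _; rewrite mvE.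
by rewrite /f0; case: ifP => _; ring.
Qed.

(** The remainder [f0] does not involve v, so setting v = w leaves it unchanged: it is the value of
    f there. *)
Lemma ps_division : subst (ev v w) f = 0 ->
  exists g, f = (ps_var R v - ps_var R w) * g.
Proof.
have hev := @ev_ord v w.
rewrite {1}division_split substD substM // substB !subst_var //.
rewrite /ev eqxx eq_sym (negbTE nvw) subrr mul0r add0r subst_fix //.
  by move=> E; exists q; rewrite [LHS]division_split E addr0.
move=> b; rewrite /f0; case: eqP => // bv _.
rewrite /mprod -[b in RHS](_ : (fun x => \sum_y b y * delta y x)%N = b).
  rewrite -mono_prod; apply: eq_bigr => x _.
  rewrite -monoX -ps_varE; case: eqP => // ->; by rewrite bv !expr0.
apply: funext => x; rewrite (bigD1 x) //= {1}/delta eqxx muln1 big1 ?addn0 // => y ny.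
by rewrite /delta eq_sym (negbTE ny) muln0.
Qed.
End Division.

End Variables.

(** * Series in one variable and their comparison with polynomials *)

Section Univariate.
Variable R : comNzRingType.
Implicit Types (m : unit -> nat) (p : {poly R}).

Lemma box_unit (T : nmodType) N (F : (unit -> nat) -> T) :
  \sum_(b : box unit N) F (bval b) = \sum_(k < N.+1) F (fun=> k).
Proof.
rewrite (reindex (fun k : 'I_N.+1 => [ffun=> k] : box unit N)) /=.
  by apply: eq_bigr => k _; congr F; apply: funext => -[]; rewrite ffunE.
exists (fun b : box unit N => b tt) => [k _|b _]; first by rewrite ffunE.
by apply/ffunP => -[]; rewrite ffunE.
Qed.

Lemma box_bool (T : nmodType) N (F : (bool -> nat) -> T) :
  \sum_(b : box bool N) F (bval b) =
  \sum_(k < N.+1) \sum_(l < N.+1) F (fun x => if x then k : nat else l).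
Proof.
rewrite pair_bigA /=.
rewrite (reindex (fun k : 'I_N.+1 * 'I_N.+1 =>
  [ffun x : bool => if x then k.1 else k.2] : box bool N)) /=.
  by apply: eq_bigr => k _; congr F; apply: funext => -[]; rewrite ffunE.
exists (fun b : box bool N => (b true, b false)) => [[k l] _|b _] /=.
  by rewrite !ffunE.
by apply/ffunP => -[]; rewrite ffunE.
Qed.

Lemma mdeg_unit m : mdeg m = m tt.
Proof. by rewrite /mdeg (bigD1 tt) //= big1 ?addn0 // => -[]. Qed.

Lemma unit_fun m : m = fun=> m tt.
Proof. by apply: funext => -[]. Qed.

(** [fgl_inv_coef] and [invP_coef] are read off from powers of polynomials; this carries them into
    the ring of series. *)
Definition ps_of_poly p : ps R unit := fun m => p`_(m tt).

Lemma ps_of_polyM p q : ps_of_poly (p * q) = ps_of_poly p * ps_of_poly q.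
Proof.
apply: funext => m; rewrite /ps_of_poly coefM -[RHS]/(ps_mul _ _ m) /ps_mul.
rewrite [RHS]big_mkcond /= -/(mle _ m).
pose F (b : unit -> nat) := if mle b m then p`_(b tt) * q`_(m tt - b tt) else 0.
rewrite -[RHS]/(\sum_(b : box unit (mdeg m)) F (bval b)) box_unit mdeg_unit.
apply: eq_bigr => k _; rewrite /F; case: mleP => // [[]] -[].
by rewrite -ltnS ltn_ord.
Qed.

Lemma ps_of_polyX : ps_of_poly 'X = ps_var R tt.
Proof.
apply: funext => m; rewrite /ps_of_poly coefX ps_varE /mono; case: eqmP => [->|h] //.
case: eqP => // E; case: h; rewrite (unit_fun m) E; by apply: funext => -[].
Qed.

Lemma ps_of_poly1 : ps_of_poly 1 = 1.
Proof.
apply: funext => m; rewrite /ps_of_poly coef1 -mono0 /mono; case: eqmP => [->|h] //.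
by case: eqP => // E; case: h; rewrite (unit_fun m) E.
Qed.

Lemma ps_of_poly_exp p k : ps_of_poly (p ^+ k) = ps_of_poly p ^+ k.
Proof. by elim: k => [|k IH]; rewrite ?ps_of_poly1 // !exprS ps_of_polyM IH. Qed.

Lemma mprod_unit (V : finType) (g : ps R V) k : mprod (fun _ : unit => g) (fun=> k) = g ^+ k.
Proof. by rewrite /mprod (bigD1 tt) //= big1 ?mulr1 // => -[]. Qed.

Lemma ps_comp1E (V : finType) (c : nat -> R) (g : ps R V) :
  ps_comp1 c g = subst (fun=> g) (fun b : unit -> nat => c (b tt)).
Proof.
apply: funext => m; rewrite /ps_comp1 /subst.
rewrite (box_unit (mdeg m) (fun b => c (b tt) * mprod (fun=> g) b m)).
by apply: eq_bigr => k _; rewrite ps_expE mprod_unit.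
Qed.

Lemma coef_subst_var (V : finType) (v : V) (c : ps R unit) (m : V -> nat) :
  subst (fun=> ps_var R v) c m =
  if eqm m (fun x => m v * delta v x)%N then c (fun=> m v) else 0.
Proof.
rewrite /subst (box_unit (mdeg m) (fun b => c b * mprod (fun=> ps_var R v) b m)).
have E k : mprod (fun _ : unit => ps_var R v) (fun=> k) = mono R (fun x => k * delta v x)%N.
  by rewrite mprod_unit ps_varE monoX.
have hk : (m v < (mdeg m).+1)%N by rewrite ltnS mdeg_ge.
rewrite (bigD1 (Ordinal hk)) //= E big1 ?addr0.
  by rewrite /mono; case: ifP; rewrite ?mulr1 ?mulr0.
move=> k nk; rewrite E /mono; case: eqmP => // M; last by rewrite mulr0.
case/eqP: nk; apply: val_inj => /=; have := congr1 (@^~ v) M.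
by rewrite /delta eqxx muln1.
Qed.

End Univariate.

(** * The formal inverse, and the factor gamma of F(u, bar x) *)

Section FGL.
Variables (R : comNzRingType) (a : nat -> nat -> R).

Definition fgl_mixed : ps R bool :=
  fun b => if (0 < b true)%N && (0 < b false)%N then a (b true) (b false) else 0.
Definition pair_fun (V : Type) (A B : V) (x : bool) := if x then A else B.

Section Eval.
Variable V : finType.
Implicit Types A B : ps R V.

Lemma fgl_evalE A B : fgl_eval a A B = A + B + subst (pair_fun A B) fgl_mixed.
Proof.
apply: funext => m; rewrite psDE psDE /fgl_eval /subst; congr (_ + _).
rewrite (box_bool (mdeg m) (fun b => fgl_mixed b * mprod (pair_fun A B) b m)).
apply: eq_bigr => k _; apply: eq_bigr => l _; rewrite !ps_expE /fgl_mixed.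
case: ifP => _; rewrite ?mul0r //.
by rewrite /mprod big_bool.
Qed.

Lemma pair_fun_ord A B : ordge 1 A -> ordge 1 B -> forall x, ordge 1 (pair_fun A B x).
Proof. by move=> hA hB []. Qed.

Lemma fgl_mixed_ord : ordge 1 fgl_mixed.
Proof. by apply: ordge1_coef. Qed.

Lemma fgl_eval_ord A B : ordge 1 A -> ordge 1 B -> ordge 1 (fgl_eval a A B).
Proof.
move=> hA hB; rewrite fgl_evalE; apply: ordgeD; first exact: ordgeD.
by apply: subst_ord; [apply: pair_fun_ord | apply: fgl_mixed_ord].
Qed.

Lemma fgl_evalr0 A : fgl_eval a A 0 = A.
Proof.
apply: funext => m; rewrite /fgl_eval ps0E addr0 big1 ?addr0 // => k _.
apply: big1 => l _; case: ifP => // /andP[_ hl]; rewrite !ps_expE.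
by rewrite expr0n gtn_eqF // [ps_mul _ _](mulr0 (A ^+ k)) ps0E mulr0.
Qed.

Lemma fgl_eval0r A : fgl_eval a 0 A = A.
Proof.
apply: funext => m; rewrite /fgl_eval ps0E add0r big1 ?addr0 // => k _.
apply: big1 => l _; case: ifP => // /andP[hk _]; rewrite !ps_expE.
by rewrite expr0n gtn_eqF // [ps_mul _ _](mul0r (A ^+ l)) ps0E mulr0.
Qed.

End Eval.

Definition inv_series : ps R unit := fun b => fgl_inv_coef a (b tt).

Lemma ps_barE (V : finType) (A : ps R V) : ps_bar a A = subst (fun=> A) inv_series.
Proof. exact: ps_comp1E. Qed.

Lemma inv_series_ord : ordge 1 inv_series.
Proof. exact: ordge1_coef. Qed.

Lemma ps_bar_ord (V : finType) (A : ps R V) : ordge 1 A -> ordge 1 (ps_bar a A).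
Proof. by move=> hA; rewrite ps_barE; apply: subst_ord => //; apply: inv_series_ord. Qed.

Section SubstEval.
Variables (V W : finType) (h : V -> ps R W).
Hypothesis hh : forall v, ordge 1 (h v).

Lemma subst_fgl A B : ordge 1 A -> ordge 1 B ->
  subst h (fgl_eval a A B) = fgl_eval a (subst h A) (subst h B).
Proof.
move=> hA hB; rewrite !fgl_evalE !substD subst_comp //; last exact: pair_fun_ord.
by congr (_ + _); apply: eq_subst => -[].
Qed.

Lemma subst_comp1 c A : ordge 1 A -> subst h (ps_comp1 c A) = ps_comp1 c (subst h A).
Proof. by move=> hA; rewrite !ps_comp1E subst_comp. Qed.

Lemma subst_bar A : ordge 1 A -> subst h (ps_bar a A) = ps_bar a (subst h A).
Proof. exact: subst_comp1. Qed.
End SubstEval.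

Lemma size_inv_list n : size (fgl_inv_list a n) = n.+1.
Proof. by elim: n => //= n IH; rewrite size_rcons IH. Qed.

Lemma nth_inv_list n i : (i <= n)%N -> nth 0 (fgl_inv_list a n) i = fgl_inv_coef a i.
Proof.
elim: n => [|n IH]; first by rewrite leqn0 => /eqP ->.
rewrite leq_eqVlt ltnS => /orP[/eqP -> //|hi].
by rewrite /= nth_rcons size_inv_list ltnS hi IH.
Qed.

Lemma fgl_inv_series : fgl_eval a (ps_var R tt) inv_series = 0.
Proof.
apply: funext => m; rewrite ps0E /fgl_eval mdeg_unit.
move En : (m tt) => n; have -> : m = fun=> n by rewrite (unit_fun m) En.
case: n {m En} => [|n].
  rewrite big_ord1 big_ord1 /= /inv_series addr0 ps_varE /mono.
  case: eqmP => [/(congr1 (@^~ tt))//|_]; exact: addr0.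
rewrite {1}/inv_series /fgl_inv_coef /= nth_rcons size_inv_list ltnn eqxx /fgl_inv_next.
have -> : ps_var R tt (fun=> n.+1) = (nat_of_bool (n.+1 == 1%N))%:R.
  rewrite ps_varE /mono; case: eqmP => [/(congr1 (@^~ tt))->|h] //.
  by case: eqP => // -[E]; case: h; rewrite E; apply: funext => -[].
set S := (X in _ - (_ + X) + _); set S' := (X in _ + X = 0).
suff -> : S' = S by ring.
apply: eq_bigr => k _; apply: eq_bigr => l _; case: ifP => // /andP[hk _].
congr (_ * _); rewrite !ps_expE -[LHS]/((ps_var R tt ^+ k * inv_series ^+ l) (fun=> n.+1)).
rewrite -[RHS]/(ps_of_poly _ (fun _ : unit => n.+1)) ps_of_polyM !ps_of_poly_exp ps_of_polyX.
(* As k >= 1, one factor z splits off; the inverse series is then needed only up to degree n, where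
   it agrees with the recursively computed list. *)
rewrite -(prednK hk) exprS -!mulrA; apply: (eqd_varM (N := n)); last by rewrite mdeg_unit.
apply: eqdM => //; apply: eqdX => m; rewrite mdeg_unit => hm.
by rewrite /inv_series /ps_of_poly coef_Poly nth_inv_list.
Qed.

Lemma fgl_bar (V : finType) (A : ps R V) : ordge 1 A -> fgl_eval a A (ps_bar a A) = 0.
Proof.
move=> hA; have := congr1 (subst (fun=> A)) fgl_inv_series.
rewrite subst_fgl ?subst0 ?subst_var -?ps_barE //; first exact: ordge_var.
exact: inv_series_ord.
Qed.

Definition Pser : ps R unit := fun m => if m tt == 0%N then 1 else a (m tt) 1%N.

Lemma invP_Pser : ((fun b => invP_coef a (b tt)) : ps R unit) * Pser = 1 :> ps R unit.
Proof.
pose h : ps R unit := fun m => if m tt == 0%N then 0 else a (m tt) 1%N.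
have hh : ordge 1 h by apply: ordge1_coef.
have -> : Pser = 1 + h.
  apply: funext => m; rewrite psDE -mono0 /mono /Pser /h; case: eqP => m0.
    by rewrite addr0; case: eqmP => // [[]]; rewrite (unit_fun m) m0.
  by case: eqmP => [E|_]; [rewrite E in m0 | rewrite add0r].
suff -> : ((fun b => invP_coef a (b tt)) : ps R unit) = geo h by rewrite mulrC geoP.
apply: funext => m; rewrite /geo ps_sumE mdeg_unit /invP_coef coef_sum.
apply: eq_bigr => k _.
(* The polynomial in [invP_coef] is P - 1 truncated at the degree of the coefficient computed, so
   its powers agree with those of the series up to there. *)
rewrite -[LHS]/(ps_of_poly _ m) ps_of_poly_exp; apply: (eqdX (N := m tt)); last by rewrite mdeg_unit.
move=> m'; rewrite mdeg_unit => hm.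
rewrite /ps_of_poly coefN psNE coef_sum /h; congr (- _).
have [->|m0] := eqVneq (m' tt) 0%N.
  by rewrite big_nat big1 // => i /andP[i0 _]; rewrite coefZ coefXn ltn_eqF ?mulr0.
rewrite (bigD1_seq (m' tt)) ?iota_uniq ?mem_index_iota ?lt0n ?m0 ?ltnS //=.
rewrite coefZ coefXn eqxx mulr1 big1 ?addr0 // => i ni.
by rewrite coefZ coefXn eq_sym (negbTE ni) mulr0.
Qed.

Local Notation e := (ps_var R true).
Local Notation u := (ps_var R false).

Hypothesis fgla : is_fgl a.

Lemma fgl_cancel : fgl_eval a (fgl_eval a e u) (ps_bar a u) = e.
Proof.
have [_ /funext assoc] := fgla.
pose h (i : 'I_3) : ps R bool := nth e [:: e; u; ps_bar a u] i.
have he := @ordge_var R _ true; have hu := @ordge_var R _ false.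
have hb := ps_bar_ord hu.
have hh i : ordge 1 (h i) by rewrite /h; case: i => -[|[|[|i]]] //= _.
have hv (i : 'I_3) : ordge 1 (ps_var R i) by apply: ordge_var.
have := congr1 (subst h) assoc.
rewrite !(subst_fgl hh) ?subst_var //; try exact: fgl_eval_ord.
by rewrite /h !inordK //= (fgl_bar hu) fgl_evalr0.
Qed.

(* Writing F(w, bar u) = (w - u) gamma(w, u), associativity with third argument bar u
   reads (F(e, u) - u) gamma(F(e, u), u) = e; dividing by e and setting e = 0 gives
   P(u) gamma(u, u) = 1. *)
Lemma fgl_factor : exists gamma : ps R bool,
  [/\ gamma (@zerom bool) = 1,
     fgl_eval a e (ps_bar a u) = (e - u) * gamma &
     subst (fun=> u) Pser * subst (fun=> u) gamma = 1].
Proof.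
have he := @ordge_var R _ true; have hu := @ordge_var R _ false.
have hb := ps_bar_ord hu.
have [//|gamma gammaE] := @ps_division R _ true false (fgl_eval a e (ps_bar a u)) isT.
  have hev := @ev_ord R _ true false.
  by rewrite subst_fgl // subst_bar // !subst_var // fgl_bar.
exists gamma; suff main : subst (fun=> u) Pser * subst (fun=> u) gamma = 1.
  split=> //; have := congr1 (fun f : ps R bool => f (@zerom bool)) main.
  rewrite ps_coef0M !subst_coef0 // /Pser /= mul1r -mono0 /mono.
  by case: eqmP.
have hF := fgl_eval_ord he hu.
have hp := pair_fun_ord hF hu.
pose K' : ps R bool := fun m => fgl_mixed (addm (delta true) m).
have FE : fgl_eval a e u - u = e * (1 + K').
  rewrite fgl_evalE (_ : subst _ _ = fgl_mixed).
    rewrite {1}(@var_divE _ _ true fgl_mixed) -/K'; first by ring.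
    by move=> m m0; rewrite /fgl_mixed m0.
  by rewrite -[RHS]subst_vars; apply: eq_subst => -[].
have := congr1 (subst (pair_fun (fgl_eval a e u) u)) gammaE.
rewrite subst_fgl // subst_bar // substM // substB !subst_var // fgl_cancel FE.
rewrite -mulrA -{1}[e]mulr1 => /var_lreg/esym E1.
have h0 : forall x, ordge 1 (pair_fun (0 : ps R bool) u x) by apply: pair_fun_ord.
have := congr1 (subst (pair_fun 0 u)) E1; rewrite subst1 // substM //.
rewrite subst_comp // => <-; congr (_ * _); last first.
  apply: eq_subst => -[] /=; last by rewrite subst_var.
  by rewrite subst_fgl // !subst_var // fgl_eval0r.
have -> : 1 + K' = subst (fun=> u) Pser + (1 + K' - subst (fun=> u) Pser) by ring.
rewrite substD subst_comp // [X in _ = _ + X](_ : _ = 0) ?addr0.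
  by apply: eq_subst => x; rewrite subst_var.
rewrite (@var_divE _ _ true (1 + K' - _)) ?substM // ?subst_var ?mul0r // => m m0.
(* Among the terms free of e, the coefficient of u^k with k >= 1 is a_{1,k} in 1 + K' and a_{k,1} in
   P(u); commutativity of the group law identifies them. *)
rewrite psBE psDE coef_subst_var /K' /Pser /fgl_mixed /addm m0 -mono0 /mono.
case: eqmP => [->|nm]; last first.
  rewrite /delta /= add0n add1n /=.
  case: eqmP => [_|[]]; last first.
    by apply: funext => -[]; rewrite /= ?m0 ?muln0 ?muln1.
  rewrite add0r lt0n; case: eqP => [mf|_] /=; last by rewrite fgla.1 subrr.
  by case: nm; apply: funext => -[].
by rewrite /= addr0; case: eqmP => [_|[]]; rewrite ?subrr.
Qed.

(** Substitution carries the two-variable factorization to arbitrary A and B, and uniqueness of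
    inverses turns P(A) gamma(A, A) = 1 into a formula for 1/P(A). *)
Theorem fgl_difference : exists gamma : ps R bool, gamma (@zerom bool) = 1 /\
  forall (V : finType) (A B : ps R V), ordge 1 A -> ordge 1 B ->
    fgl_eval a A (ps_bar a B) = (A - B) * subst (pair_fun A B) gamma /\
    ps_comp1 (invP_coef a) A = subst (pair_fun A A) gamma.
Proof.
have he := @ordge_var R _ true; have hu := @ordge_var R _ false.
have hb := ps_bar_ord hu.
have [gamma [g0 gE gP]] := fgl_factor; exists gamma; split=> // V A B hA hB.
have hAB := pair_fun_ord hA hB; have hAA := pair_fun_ord hA hA; split.
  have := congr1 (subst (pair_fun A B)) gE.
  by rewrite subst_fgl // subst_bar // substM // substB !subst_var.
have := congr1 (subst (pair_fun A A)) gP.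
rewrite subst1 // substM // !subst_comp // ?subst_var // => E.
have := congr1 (subst (fun=> A)) invP_Pser; rewrite substM // subst1 // -ps_comp1E => E2.
apply: (@inv_uniq _ (subst (fun=> A) Pser)); first by rewrite mulrC.
by rewrite -[RHS]E; congr (_ * _); apply: eq_subst => x; rewrite ?subst_var //; case: x.
Qed.

End FGL.

(** * Laurent series *)

Section Laurent.
Variables (R : comNzRingType) (n r : nat).
Local Notation V := ('I_r + 'I_n)%type.
Local Notation PR := (ps R 'I_r).
Implicit Types (f g : ps R V) (al : 'I_n -> nat) (ga : 'I_r -> nat) (m : V -> nat).
Implicit Types (E : ls R n r).

Definition comb ga al : V -> nat :=
  fun v => match v with inl i => ga i | inr j => al j end.
Definition upart m : 'I_r -> nat := fun i => m (inl i).
Definition xpart m : 'I_n -> nat := fun j => m (inr j).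

Lemma combK m : comb (upart m) (xpart m) = m.
Proof. by apply: funext => -[]. Qed.

Lemma comb_inj ga ga' al al' : comb ga al = comb ga' al' -> ga = ga' /\ al = al'.
Proof.
move=> h; split; apply: funext => i; first exact: (congr1 (@^~ (inl i)) h).
exact: (congr1 (@^~ (inr i)) h).
Qed.

Lemma eqm_comb ga ga' al al' : eqm (comb ga al) (comb ga' al') = eqm ga ga' && eqm al al'.
Proof.
apply/eqmP/andP => [/comb_inj[-> ->]|[/eqmP -> /eqmP ->] //].
by split; apply/eqmP.
Qed.

Lemma mle_comb ga ga' al al' : mle (comb ga al) (comb ga' al') = mle ga ga' && mle al al'.
Proof.
apply/mleP/andP => [h|[/mleP h /mleP h'] []//].
by split; apply/mleP => i; [apply: (h (inl i)) | apply: (h (inr i))].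
Qed.

Lemma addm_comb ga ga' al al' :
  addm (comb ga al) (comb ga' al') = comb (addm ga ga') (addm al al').
Proof. by apply: funext => -[]. Qed.

Lemma subm_comb ga ga' al al' :
  subm (comb ga al) (comb ga' al') = comb (subm ga ga') (subm al al').
Proof. by apply: funext => -[]. Qed.

Lemma mdeg_comb ga al : mdeg (comb ga al) = (mdeg ga + mdeg al)%N.
Proof. by rewrite /mdeg big_sumType. Qed.

Lemma box_comb (T : nmodType) N (F : (V -> nat) -> T) :
  \sum_(b : box V N) F (bval b) =
  \sum_(b : box 'I_r N) \sum_(c : box 'I_n N) F (comb (bval b) (bval c)).
Proof.
rewrite pair_bigA /=.
rewrite (reindex (fun p : box 'I_r N * box 'I_n N =>
  [ffun v : V => match v with inl i => p.1 i | inr j => p.2 j end] : box V N)) /=.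
  by apply: eq_bigr => p _; congr F; apply: funext => -[] i; rewrite ffunE.
exists (fun b : box V N => ([ffun i => b (inl i)], [ffun j => b (inr j)])) => [[p q] _|b _] /=.
  by congr pair; apply/ffunP => i; rewrite !ffunE.
by apply/ffunP => -[] i; rewrite !ffunE.
Qed.

(** The x-coefficients become elements of the ring of series in u, so the ring structure is used a
    second time, over itself. *)
Definition curry f : ps PR 'I_n := fun al ga => f (comb ga al).

Lemma curry_inj f g : curry f = curry g -> f = g.
Proof.
move=> h; apply: funext => m; rewrite -(combK m).
exact: (congr1 (fun F : ps PR 'I_n => F (xpart m) (upart m)) h).
Qed.

Lemma curryD f g : curry (f + g) = curry f + curry g.
Proof. by []. Qed.

Lemma curryM f g : curry (f * g) = curry f * curry g.
Proof.
apply: funext => al; apply: funext => ga; pose N := (mdeg ga + mdeg al)%N.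
have hga i : (ga i <= N)%N by apply: leq_trans (mdeg_ge ga i) (leq_addr _ _).
have hal j : (al j <= N)%N by apply: leq_trans (mdeg_ge al j) (leq_addl _ _).
rewrite (psME _ _ hal) ps_sumE.
rewrite -[LHS]/((f * g) (comb ga al)) (psME _ _ (N := N)); last by case.
transitivity (\sum_(b : box 'I_r N) \sum_(c : box 'I_n N)
   \sum_(b' : box 'I_r N) \sum_(c' : box 'I_n N)
    if eqm (addm (bval b) (bval b')) ga && eqm (addm (bval c) (bval c')) al then
      f (comb (bval b) (bval c)) * g (comb (bval b') (bval c')) else 0).
  rewrite (box_comb N (fun b => \sum_(c : box V N)
    (if eqm (addm b (bval c)) (comb ga al) then f b * g (bval c) else 0))).
  apply: eq_bigr => b _; apply: eq_bigr => c _.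
  rewrite (box_comb N (fun d =>
    (if eqm (addm (comb (bval b) (bval c)) d) (comb ga al)
     then f (comb (bval b) (bval c)) * g d else 0))).
  by apply: eq_bigr => b' _; apply: eq_bigr => c' _; rewrite addm_comb eqm_comb.
rewrite exchange_big; apply: eq_bigr => c _ /=.
under eq_bigr => b _ do rewrite exchange_big.
rewrite exchange_big ps_sumE; apply: eq_bigr => c' _ /=.
case: ifP => _; last first.
  by rewrite big1 // => b _; rewrite big1 // => b' _; rewrite andbF.
rewrite (psME _ _ hga); apply: eq_bigr => b _; apply: eq_bigr => b' _.
by rewrite andbT.
Qed.

Lemma curry_sum (I : Type) (s : seq I) (F : I -> ps R V) :
  curry (\sum_(i <- s) F i) = \sum_(i <- s) curry (F i).
Proof. exact: (big_morph curry curryD). Qed.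

Definition upow k : PR := mono R (fun=> k).

Lemma upowD j k : upow (j + k) = upow j * upow k.
Proof. by rewrite /upow monoM. Qed.

Lemma upow0 : upow 0 = 1.
Proof. exact: mono0. Qed.

Lemma upowMD k (f : PR) c : (upow k * f) (fun=> (k + c)%N) = f (fun=> c).
Proof. exact: (monoMD (fun=> k) f (fun=> c)). Qed.

Definition umono ga : ps R V := mono R (comb ga (@zerom 'I_n)).

Lemma curry_umono ga f al : curry (umono ga * f) al = mono R ga * curry f al.
Proof.
apply: funext => ga'; rewrite /curry /umono !monoME mle_comb.
have -> : mle (@zerom 'I_n) al by apply/mleP.
rewrite andbT subm_comb (_ : subm al _ = al) //.
by apply: funext => j; apply: subn0.
Qed.

(* The substitution x_j -> y_j u_1 ... u_r, where the variables of the target are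
   u_i and y_j: an x-homogeneous Laurent series whose u-exponents are at least -|al|
   at x^al is, in the variables u and y, an ordinary power series. *)
Definition shear f : ps R V :=
  fun m => (upow (mdeg (xpart m)) * curry f (xpart m)) (upart m).

Lemma curry_shear f al : curry (shear f) al = upow (mdeg al) * curry f al.
Proof. by apply: funext. Qed.

(** The x-degree is additive, so the power of u_1 ... u_r attached to x^al splits along each term of
    the convolution. *)
Lemma shearM f g : shear (f * g) = shear f * shear g.
Proof.
apply: curry_inj; apply: funext => al; rewrite curryM curry_shear curryM.
rewrite !(psME _ _ (@mdeg_ge _ al)) mulr_sumr; apply: eq_bigr => b _.
rewrite mulr_sumr; apply: eq_bigr => c _; case: eqmP => E; last by rewrite mulr0.
by rewrite -{1}E mdegD upowD !curry_shear; ring.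
Qed.

Lemma shearD f g : shear (f + g) = shear f + shear g.
Proof.
by apply: curry_inj; apply: funext => al; rewrite curryD psDE !curry_shear curryD psDE mulrDr.
Qed.

Lemma shearN f : shear (- f) = - shear f.
Proof.
apply: curry_inj; apply: funext => al; rewrite curry_shear.
rewrite -[curry (- f) al]/(- curry f al) -[RHS]/(- curry (shear f) al) curry_shear.
exact: mulrN.
Qed.

Lemma shearB f g : shear (f - g) = shear f - shear g.
Proof. by rewrite shearD shearN. Qed.

Lemma shear0 : shear 0 = 0.
Proof. by rewrite -[X in shear X](subrr 0) shearB subrr. Qed.

Lemma shear_mono m : shear (mono R m) =
  mono R (comb (fun i => m (inl i) + mdeg (xpart m))%N (xpart m)).
Proof.
apply: curry_inj; apply: funext => al; rewrite curry_shear.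
have [<-|nal] := pselect (xpart m = al).
  have E ga : curry (mono R m) (xpart m) ga = mono R (upart m) ga.
    by rewrite /curry /mono -{2}(combK m) eqm_comb [eqm (xpart m) _](introT (eqmP _ _)) ?andbT.
  rewrite (_ : curry _ _ = mono R (upart m)); last exact: funext.
  rewrite /upow monoM; apply: funext => ga; rewrite /curry /mono eqm_comb.
  rewrite [eqm (xpart m) _](introT (eqmP _ _)) ?andbT //.
  by congr (if eqm _ _ then _ else _); apply: funext => i; rewrite /addm addnC.
have E ga m' : xpart m' <> al -> (mono R m' : ps R V) (comb ga al) = 0.
  by move=> h; rewrite /mono; case: eqmP => // Em; case: h; rewrite -Em.
rewrite (_ : curry _ _ = 0) ?mulr0; last by apply: funext => ga; apply: E.
by apply: funext => ga; rewrite /curry E.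
Qed.

Lemma shear1 : shear 1 = 1.
Proof.
rewrite -!mono0 shear_mono; congr mono; apply: funext => -[] i //=.
by rewrite mdeg0.
Qed.

Lemma shear_prod (I : Type) (s : seq I) (P : pred I) (F : I -> ps R V) :
  shear (\prod_(i <- s | P i) F i) = \prod_(i <- s | P i) shear (F i).
Proof. exact: (big_morph shear shearM shear1). Qed.

Lemma shear_umono ga : shear (umono ga) = umono ga.
Proof.
rewrite /umono shear_mono; congr mono; apply: funext => -[] i //=.
by rewrite [xpart _](_ : _ = @zerom 'I_n) // mdeg0 addn0.
Qed.

Lemma umono_var i : ps_var R (inl i : V) = umono (delta i).
Proof. by rewrite ps_varE; congr mono; apply: funext => -[]. Qed.

(** The true exponent of u_i in a sheared monomial, y_j being x_j/(u_1 ... u_r). Likewise [ywt]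
    measures the degree in x. *)
Definition uwt (i : 'I_r) (v : V) : int :=
  match v with inl k => (k == i)%:Z | inr _ => -1 end.
Definition ywt (v : V) : int := match v with inl k => 0 | inr _ => 1 end.

Lemma uwtE i m : wt (uwt i) m = (m (inl i))%:Z - (mdeg (xpart m))%:Z.
Proof.
rewrite /wt big_sumType /= (bigD1 i) //= eqxx big1 => [|k /negbTE ->]; last first.
  by rewrite mul0rn.
rewrite addr0 -!natz; congr (_ + _).
by rewrite /mdeg natr_sum -sumrN; apply: eq_bigr => j _; rewrite mulNrn.
Qed.

Lemma ywtE m : wt ywt m = (mdeg (xpart m))%:Z.
Proof.
rewrite /wt big_sumType /= big1 => [|k _]; last by rewrite mul0rn.
by rewrite add0r -natz /mdeg natr_sum.
Qed.

Lemma wge_shear i f : wge (uwt i) 0 (shear f).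
Proof.
move=> m; rewrite uwtE => h; rewrite /shear monoME.
case: mleP => // /(_ i) hi; move: h hi; rewrite /upart; lia.
Qed.

(* Rep E s g says that E = (u_1 ... u_r)^-s g(u, x / (u_1 ... u_r)). *)
Definition Rep E s g := forall al,
  upow (s + mdeg al) * lco E al = upow (lsh E al) * curry g al.

Lemma Rep_ps f : Rep (ls_of_ps f) 0 (shear f).
Proof. by move=> al; rewrite curry_shear upow0 mul1r. Qed.

Lemma Rep_zero s : Rep (ls_zero R n r) s 0.
Proof.
move=> al; rewrite [lco _ _](_ : _ = 0 :> PR) // mulr0.
by rewrite [curry _ _](_ : _ = 0 :> PR) // mulr0.
Qed.

Lemma Rep_one : Rep (ls_one R n r) 0 1.
Proof. by rewrite -shear1; apply: Rep_ps. Qed.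

Lemma Rep_opp E s g : Rep E s g -> Rep (ls_opp E) s (- g).
Proof.
move=> h al; rewrite [lco _ _](_ : _ = - (lco E al : PR)) //.
by rewrite [curry _ _](_ : _ = - curry g al) // !mulrN h.
Qed.

Lemma ls_co_atE E N al : ls_co_at E N al = upow (N al - lsh E al) * lco E al.
Proof. by apply: funext => ga; rewrite monoME. Qed.

Lemma Rep_add E E' s g g' : Rep E s g -> Rep E' s g' -> Rep (ls_add E E') s (g + g').
Proof.
move=> h h' al; set N := fun al => maxn (lsh E al) (lsh E' al).
rewrite [lco _ _](_ : _ = (ls_co_at E N al : PR) + ls_co_at E' N al) //.
rewrite !ls_co_atE mulrDr curryD psDE [upow _ * (_ * _)]mulrCA h.
rewrite [X in _ + X]mulrCA h' !mulrA -!upowD subnK ?leq_maxl // subnK ?leq_maxr //.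
by rewrite mulrDr.
Qed.

Lemma Rep_mul E E' s s' g g' : Rep E s g -> Rep E' s' g' ->
  Rep (ls_mul E E') (s + s') (g * g').
Proof.
move=> h h' al; set N := lsh (ls_mul E E') al.
pose cond (b : box 'I_n (mdeg al)) := [forall j, (b j <= al j)%N].
have hN b : cond b ->
    (lsh E (bval b) + lsh E' (fun j => al j - b j)%N <= N)%N.
  by move=> hb; rewrite /N /=; apply: (leq_bigmax_cond b).
rewrite [lco _ _](_ : _ = \sum_(b | cond b)
   upow (N - (lsh E (bval b) + lsh E' (fun j => al j - b j)%N)) *
   ((lco E (bval b) : PR) * lco E' (fun j => al j - b j)%N)); last first.
  apply: funext => ga; rewrite ps_sumE; apply: eq_bigr => b _.
  by rewrite monoME.
rewrite curryM -[_ al in RHS]/(ps_mul (curry g) (curry g') al) /ps_mul !mulr_sumr.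
apply: eq_bigr => b hb.
have -> : (s + s' + mdeg al)%N =
    ((s + mdeg (bval b)) + (s' + mdeg (fun j => al j - b j)))%N.
  rewrite addnACA -mdegD; congr (_ + mdeg _)%N; apply: funext => j.
  by rewrite /addm subnKC //; move/forallP: hb.
rewrite [upow _ in LHS]upowD -[in RHS](subnK (hN b hb)) [upow (N - _ + _)]upowD [upow (lsh E _ + _)]upowD.
rewrite mulrCA mulrACA h h' -[RHS]mulrA; congr (_ * _); exact: mulrACA.
Qed.

Lemma Rep_exp E g k : Rep E 0 g -> Rep (ls_exp E k) 0 (g ^+ k).
Proof.
move=> h; elim: k => [|k IH]; first exact: Rep_one.
by rewrite exprS; apply: (Rep_mul h IH).
Qed.

Lemma Rep_sum (I : Type) (l : seq I) (E : I -> ls R n r) s (g : I -> ps R V) :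
  (forall i, Rep (E i) s (g i)) ->
  Rep (ls_sum [seq E i | i <- l]) s (\sum_(i <- l) g i).
Proof.
move=> h; elim: l => [|i l IH]; first by rewrite big_nil; apply: Rep_zero.
by rewrite big_cons; apply: Rep_add.
Qed.

Lemma Rep_prod_cat (I : Type) (l : seq I) (E : I -> ls R n r) s (g : I -> ps R V) l' s' g' :
  (forall i, Rep (E i) s (g i)) -> Rep (ls_prod l') s' g' ->
  Rep (ls_prod ([seq E i | i <- l] ++ l')) (s * size l + s') (\prod_(i <- l) g i * g').
Proof.
move=> h h'; elim: l => [|i l IH]; first by rewrite big_nil muln0 mul1r.
by rewrite big_cons mulnS -mulrA -addnA; apply: Rep_mul.
Qed.

(** The encoded inverse stops at the x-degree |al|, [geo] at the total degree; the powers in between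
    vanish at x^al because g has x-order at least 1. *)
Lemma Rep_geominv E g : wge ywt 1 g -> Rep E 0 g -> Rep (ls_geominv E) 0 (geo g).
Proof.
move=> hg h al.
have := Rep_sum (iota 0 (mdeg al).+1) (fun k => Rep_exp k (Rep_opp h)) al.
rewrite [in X in X -> _]curry_sum => ->; congr (_ * _); rewrite ps_sumE.
apply: funext => ga; rewrite ps_sumE {2}/curry /geo ps_sumE mdeg_comb.
rewrite -(big_mkord xpredT (fun k => ((- g) ^+ k) (comb ga al))).
rewrite [RHS](big_cat_nat (n := (mdeg al).+1)) ?ltnS ?leq_addl //=.
rewrite [X in _ = _ + X]big_nat_cond [X in _ = _ + X]big1 ?addr0 /index_iota ?subn0 // => k.
rewrite andbT => /andP[hk _]; apply: (wgeX (k := k) (wgeN hg)).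
by rewrite ywtE [xpart _](_ : _ = al) // natz ltz_nat.
Qed.

(** The exponent of (u_1 ... u_r)/u_j: dividing by u_j is multiplying by this monomial and raising
    the shift by one. *)
Definition others (j : 'I_r) : 'I_r -> nat := fun i => nat_of_bool (i != j).

Lemma others_delta j : addm (others j) (delta j) = fun=> 1%N.
Proof. by apply: funext => i; rewrite /addm /others /delta; case: eqP. Qed.

Lemma Rep_divu E s g j : Rep E s (ps_var R (inl j : V) * g) -> Rep (ls_divu j E) s g.
Proof.
move=> h al; rewrite [lco _ _](_ : _ = mono R (others j) * lco E al :> PR).
  rewrite mulrCA h umono_var curry_umono /= -addn1 upowD.
  rewrite [upow 1](_ : _ = mono R (others j) * mono R (delta j)); first by ring.
  by rewrite monoM others_delta.
apply: funext => ga; rewrite monoME /=.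
congr (if _ then lco E al _ else _).
  apply: eq_forallb => i; rewrite /others; by case: eqP.
apply: funext => i; rewrite /subm /others; case: eqP => _ /=; lia.
Qed.

Lemma Rep_raise E s g t : Rep E s g -> Rep E (s + t) (umono (fun=> t) * g).
Proof.
move=> h al; rewrite curry_umono mulrCA -h -/(upow t) mulrA -upowD.
by congr (upow _ * _); lia.
Qed.

(** The coefficient of (u_1 ... u_r)^c, as a series in x: passing from y back to x lowers each
    u-exponent at x^al by |al|, whence the index c + |al|. *)
Definition rho c f : ps R 'I_n := fun al => curry f al (fun=> (c + mdeg al)%N).

Lemma rhoD c f g : rho c (f + g) = rho c f + rho c g. Proof. by []. Qed.

Lemma rho0 c : rho c 0 = 0. Proof. by []. Qed.

Lemma rho_raise c k f : rho (k + c) (umono (fun=> k) * f) = rho c f.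
Proof.
by apply: funext => al; rewrite /rho curry_umono -addnA (upowMD k).
Qed.

(** Multiplication by u^lam moves the exponent -lam to the diagonal. The default 0 of [ls_coef_neg]
    matches the vanishing of a monomial multiple at exponents it does not divide. *)
Lemma coef_neg_Rep E s g lam al : Rep E s g ->
  ls_coef_neg E al lam = rho s (umono lam * g) al.
Proof.
move=> h; transitivity ((mono R lam * lco E al) (fun=> lsh E al)).
  by rewrite monoME.
transitivity ((upow (s + mdeg al) * (mono R lam * lco E al))
    (fun=> (s + mdeg al + lsh E al)%N)); first by rewrite upowMD.
by rewrite mulrCA h mulrCA addnC upowMD /rho curry_umono.
Qed.

Definition emb (f : ps R 'I_n) : ps R V := subst (fun j => ps_var R (inr j : V)) f.

Lemma emb_ord j : ordge 1 (ps_var R (inr j : V)).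
Proof. exact: ordge_var. Qed.

Lemma embM (f g : ps R 'I_n) : emb (f * g) = emb f * emb g.
Proof. exact: (substM emb_ord). Qed.

Lemma emb_prod (I : Type) (s : seq I) (P : pred I) (F : I -> ps R 'I_n) :
  emb (\prod_(i <- s | P i) F i) = \prod_(i <- s | P i) emb (F i).
Proof. exact: (subst_prod emb_ord). Qed.

Lemma curry_emb (f : ps R 'I_n) al : curry (emb f) al = psC (f al).
Proof.
apply: funext => ga; rewrite /curry /emb.
pose N := (mdeg ga + mdeg al)%N.
rewrite (substE emb_ord f (N := N)); last by rewrite mdeg_comb.
have E b : mprod (fun j => ps_var R (inr j : V)) b = mono R (comb (@zerom 'I_r) b).
  rewrite /mprod; under eq_bigr => j _ do rewrite ps_varE monoX.
  rewrite mono_prod; congr mono; apply: funext => -[] i /=.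
    by rewrite big1 // => j _; rewrite muln0.
  rewrite (bigD1 i) //= {1}/delta eqxx muln1 big1 ?addn0 // => j nj.
  by rewrite /delta (inj_eq inr_inj) eq_sym (negbTE nj) muln0.
rewrite /psC -[RHS](box_pick (N := N) (fun b => if eqm ga (@zerom 'I_r) then f b else 0)); last first.
  by move=> j; apply: leq_trans (mdeg_ge al j) (leq_addl _ _).
apply: eq_bigr => b _; rewrite E /mono eqm_comb [eqm (bval b) _]eqm_sym.
by case: (eqm ga _); case: (eqm al _); rewrite /= ?mulr1 ?mulr0.
Qed.

(** In sheared form x^b carries (u_1 ... u_r)^|b|, exactly the change of the index c + |al|; so
    [rho] is linear over series in x. *)
Lemma rho_emb c (f : ps R 'I_n) g : rho c (shear (emb f) * g) = f * rho c g.
Proof.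
apply: funext => al; rewrite /rho curryM.
rewrite !(psME _ _ (@mdeg_ge _ al)) ps_sumE; apply: eq_bigr => b _.
rewrite ps_sumE; apply: eq_bigr => d _; case: eqmP => // E.
have hD : (c + mdeg al = mdeg (bval b) + (c + mdeg (bval d)))%N.
  by rewrite addnCA -mdegD E.
by rewrite curry_shear curry_emb -mulrA hD upowMD psCME.
Qed.

(* ufrac i j is u_i/(u_i - x_j) = sum_k (x_j/u_i)^k, where x_j/u_i reads y_j prod_(k <> i) u_k. *)
Definition quot_mono (i : 'I_r) (j : 'I_n) : ps R V := mono R (comb (others i) (delta j)).
Definition ufrac i j : ps R V := geo (- quot_mono i j).

Lemma shear_xvar j i : shear (ps_var R (inr j : V)) = ps_var R (inl i : V) * quot_mono i j.
Proof.
rewrite umono_var /umono /quot_mono monoM addm_comb add0m ps_varE shear_mono.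
rewrite addmC others_delta; congr mono; apply: funext => -[] k //=.
by rewrite [xpart _](_ : _ = delta j) ?mdeg_delta.
Qed.

Lemma shear_uvar i : shear (ps_var R (inl i : V)) = ps_var R (inl i : V).
Proof. by rewrite umono_var shear_umono. Qed.

Lemma ordge_quot i j : ordge 1 (quot_mono i j).
Proof.
apply/ordgeE; apply: wge_mono; rewrite wt1 mdeg_comb mdeg_delta; lia.
Qed.

Lemma ufrac_inv i j : ufrac i j * (1 - quot_mono i j) = 1.
Proof. by rewrite mulrC geoP //; apply: ordgeN; apply: ordge_quot. Qed.

Lemma ufracE i j :
  ufrac i j * shear (ps_var R (inl i : V) - ps_var R (inr j : V)) = ps_var R (inl i : V).
Proof.
rewrite shearB shear_uvar (shear_xvar j i) -{1}[ps_var R (inl i)]mulr1 -mulrBr.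
by rewrite mulrCA ufrac_inv mulr1.
Qed.

Lemma wge_ufrac i k j : k != i -> wge (uwt i) 0 (ufrac k j).
Proof.
move=> nki; apply: wge_geo; apply: wgeN; apply: wge_mono; rewrite uwtE /=.
by rewrite [xpart _](_ : _ = delta j) // mdeg_delta /others eq_sym nki.
Qed.

Lemma wge_ufrac_neg i k j : wge (fun v => - uwt i v) 0 (ufrac k j).
Proof.
have E m : wt (fun v => - uwt i v) m = - wt (uwt i) m.
  by rewrite /wt -sumrN; apply: eq_bigr => v _; rewrite mulNrn.
apply: wge_geo; apply: wgeN; apply: wge_mono; rewrite E uwtE /=.
rewrite [xpart _](_ : _ = delta j) // mdeg_delta /others; by case: eqP.
Qed.

Lemma rho_neg c i d f : wge (uwt i) d f -> (c%:Z < d) -> rho c f = 0.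
Proof.
move=> h hd; apply: funext => al; apply: h; rewrite uwtE.
rewrite [xpart _](_ : _ = al) //=; lia.
Qed.

(** No positive power of any u_i occurs in the product, and each nonconstant term of a factor has a
    negative one that nothing can compensate; only the constant term 1 reaches the exponent 0. *)
Lemma rho_prod_ufrac (p : 'I_r -> 'I_n) (l : seq 'I_r) :
  rho 0 (\prod_(i <- l) ufrac i (p i)) = 1.
Proof.
elim: l => [|i l IH].
  rewrite big_nil; apply: funext => al; rewrite /rho /curry add0n -!mono0 /mono.
  case: eqmP => [/(congr1 xpart) E|nE]; first by case: eqmP => // [[]].
  by case: eqmP => // E; case: nE; apply: funext => -[] k; rewrite E /= ?mdeg0.
have E : ufrac i (p i) = 1 + quot_mono i (p i) * ufrac i (p i).
  by rewrite -[X in X + _](ufrac_inv i (p i)); ring.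
rewrite big_cons E mulrDl mul1r rhoD IH -[RHS]addr0; congr (_ + _).
have H : wge (fun v => - uwt i v) (1 + 0)
    (quot_mono i (p i) * (ufrac i (p i) * \prod_(k <- l) ufrac k (p k))).
  apply: wgeM.
    apply: wge_mono.
    rewrite /wt; under eq_bigr => v _ do rewrite mulNrn.
    rewrite sumrN -/(wt (uwt i) _) uwtE /= [xpart _](_ : _ = delta (p i)) // mdeg_delta.
    by rewrite /others eqxx.
  rewrite -[0]addr0; apply: wgeM; first exact: wge_ufrac_neg.
  by apply: wge_prod => k _; apply: wge_ufrac_neg.
apply: funext => al; rewrite -mulrA; apply: H.
rewrite /wt; under eq_bigr => v _ do rewrite mulNrn.
rewrite sumrN -/(wt (uwt i) _) uwtE [xpart _](_ : _ = al) //=; lia.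
Qed.

End Laurent.

(** * Residues by interpolation *)

Lemma lreg_prod (R : comNzRingType) (I : Type) (s : seq I) (P : pred I) (F : I -> R) :
  (forall i, P i -> GRing.lreg (F i)) -> GRing.lreg (\prod_(i <- s | P i) F i).
Proof.
move=> h; apply: (big_ind (@GRing.lreg R)) => //; first exact: lreg1.
exact: lregM.
Qed.

Section Interpolation.
Variables (R : comNzRingType) (n r : nat).
Hypothesis le_rn : (r <= n)%N.
Local Notation V := ('I_r + 'I_n)%type.
Implicit Types (B f g : ps R V) (i : 'I_r) (j p q : 'I_n).

Definition du i j : ps R V := ps_var R (inl i : V) - ps_var R (inr j : V).
Definition dx p q : ps R 'I_n := ps_var R p - ps_var R q.
Definition lagr i p : ps R V := \prod_(j | j != p) du i j.
Definition xnode p : ps R 'I_n := \prod_(j | j != p) dx p j.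
(** Up to sign the discriminant of the nodes, a common multiple of the Lagrange denominators
    [xnode p]. *)
Definition xdisc : ps R 'I_n := \prod_p xnode p.
Definition xcofactor p : ps R 'I_n := \prod_(q | q != p) xnode q.

Lemma xcofactorE p : xcofactor p * xnode p = xdisc.
Proof. by rewrite /xdisc (bigD1 p) //= mulrC. Qed.

Lemma dx_lreg p q : p != q -> GRing.lreg (dx p q).
Proof. exact: sub_var_lreg. Qed.

Lemma xnode_lreg p : GRing.lreg (xnode p).
Proof. by apply: lreg_prod => j nj; apply: dx_lreg; rewrite eq_sym. Qed.

Lemma xdisc_lreg : GRing.lreg xdisc.
Proof. by apply: lreg_prod => p _; apply: xnode_lreg. Qed.

Local Notation embr := (@emb R n r).
Local Notation evu i q := (ev R (inl i : V) (inr q : V)).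

Lemma evu_ord i q v : ordge 1 (evu i q v).
Proof. exact: ev_ord. Qed.

Lemma evu_emb i q (f : ps R 'I_n) : subst (evu i q) (embr f) = embr f.
Proof.
rewrite /emb subst_comp; [|exact: emb_ord|exact: evu_ord].
by apply: eq_subst => j; rewrite subst_var //; apply: evu_ord.
Qed.

Lemma emb_dx p q : embr (dx p q) = ps_var R (inr p : V) - ps_var R (inr q : V).
Proof. by rewrite /dx /emb substB !subst_var //; apply: emb_ord. Qed.

Lemma evu_du i q j : subst (evu i q) (du i j) = embr (dx q j).
Proof.
rewrite emb_dx /du substB !subst_var; try exact: evu_ord.
by rewrite /ev eqxx.
Qed.

Lemma evu_du_neq i k q j : k != i -> subst (evu i q) (du k j) = du k j.
Proof.
move=> nki; rewrite /du substB !subst_var; try exact: evu_ord.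
by rewrite /ev (inj_eq inl_inj) (negbTE nki).
Qed.

(** Nodes are divided out one at a time: at u_i = x_p the factors already extracted become
    differences of distinct variables, hence regular, so the quotient still vanishes there. *)
Lemma vanish_div i f (l : seq 'I_n) : uniq l ->
    (forall p, p \in l -> subst (evu i p) f = 0) ->
  exists g, f = g * \prod_(p <- l) du i p.
Proof.
elim: l => [|p l IH] /=; first by exists f; rewrite big_nil mulr1.
move=> /andP[npl ul] h.
have [|g fE] := IH ul; first by move=> q ql; apply: h; rewrite inE ql orbT.
have [//||g' gE] := @ps_division R _ (inl i : V) (inr p : V) g.
  have L : GRing.lreg (\prod_(q <- l) subst (evu i p) (du i q)).
    rewrite big_seq; apply: lreg_prod => q ql.
    rewrite evu_du emb_dx; apply: sub_var_lreg; rewrite (inj_eq inr_inj).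
    by apply: contraNneq npl => ->.
  apply: L; rewrite mulr0 mulrC -(h p (mem_head _ _)) fE substM ?subst_prod //;
  exact: evu_ord.
by exists g'; rewrite fE gE big_cons -/(du i p); ring.
Qed.

(** At u_i = x_p only the summand q = p survives, with the value of [xdisc] times f; the difference
    thus vanishes at all nodes and [vanish_div] applies. *)
Lemma interpolation i f : exists g, embr xdisc * f =
  \sum_q subst (evu i q) f * (embr (xcofactor q) * lagr i q) + g * \prod_j du i j.
Proof.
pose S := \sum_q subst (evu i q) f * (embr (xcofactor q) * lagr i q).
have [||g gE] := @vanish_div i (embr xdisc * f - S) (index_enum 'I_n).
- exact: index_enum_uniq.
- move=> p _; rewrite substB substM; last exact: evu_ord.
  rewrite evu_emb /S subst_sum (bigD1 p) //= big1 ?addr0 => [|q nqp].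
    rewrite !substM; try exact: evu_ord.
    rewrite evu_emb /lagr subst_prod; last exact: evu_ord.
    under eq_bigr => j _ do rewrite evu_du.
    rewrite -emb_prod -/(xnode p) -embM xcofactorE.
    rewrite subst_comp; try exact: evu_ord.
    rewrite [X in _ - X * _](_ : _ = subst (evu i p) f).
      by rewrite mulrC subrr.
    apply: eq_subst => v; rewrite /ev; case: ifP => [_|nv].
      by rewrite subst_var //; apply: evu_ord.
    by rewrite subst_var ?nv //; apply: evu_ord.
  rewrite !substM; try exact: evu_ord.
  rewrite /lagr subst_prod; last exact: evu_ord.
  rewrite (bigD1 p) ?evu_du 1?eq_sym //= /dx subrr.
  by rewrite /emb subst0; ring.
by exists g; rewrite -gE addrC subrK.
Qed.

Definition ufracs : ps R V := \prod_(i : 'I_r) \prod_(j : 'I_n) ufrac R i j.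

(* tau f is the coefficient of u_1^-1 ... u_r^-1 in f / prod_(i, j) (u_i - x_j),
   expanded at x = 0; ufracs multiplies the latter by (u_1 ... u_r)^n. *)
Definition tau f : ps R 'I_n := rho n.-1 (shear f * ufracs).

Lemma tauD f g : tau (f + g) = tau f + tau g.
Proof. by rewrite /tau shearD mulrDl rhoD. Qed.

Lemma tau0 : tau 0 = 0.
Proof. by rewrite /tau shear0 mul0r rho0. Qed.

Lemma tau_sum (I : Type) (s : seq I) (P : pred I) (F : I -> ps R V) :
  tau (\sum_(i <- s | P i) F i) = \sum_(i <- s | P i) tau (F i).
Proof. exact: (big_morph tau tauD tau0). Qed.

Lemma tau_emb (f : ps R 'I_n) g : tau (embr f * g) = f * tau g.
Proof. by rewrite /tau shearM -mulrA rho_emb. Qed.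

(** The numerator cancels all poles in u_i. What remains is u_i^n times a series without negative
    powers of u_i, which has no term with u_i^(n-1). *)
Lemma tau_vanish i f : tau (f * \prod_j du i j) = 0.
Proof.
have n0 : (0 < n)%N by apply: leq_trans le_rn; apply: leq_ltn_trans (ltn_ord i).
rewrite /tau shearM -mulrA.
have -> : shear (\prod_j du i j) * ufracs =
    ps_var R (inl i : V) ^+ n * \prod_(k | k != i) \prod_j ufrac R k j.
  rewrite shear_prod /ufracs (bigD1 i) //= mulrA -big_split /=.
  under eq_bigr => j _ do rewrite mulrC ufracE.
  by rewrite prodr_const card_ord.
apply: (rho_neg (i := i) (d := 0 + (1 *+ n + 0))); last by rewrite natz; lia.
apply: wgeM; first exact: wge_shear.
apply: wgeM; first (apply: wgeX; apply: wge_mono).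
  by rewrite uwtE /delta eqxx /= /mdeg big1.
by apply: wge_prod => k nk; apply: wge_prod => j _; apply: wge_ufrac.
Qed.

(** One simple pole remains for each i: the factors become u_i^(n-1)/(1 - x_{p i}/u_i), whose
    leading term gives the coefficient 1. *)
Lemma tau_lagr (p : 'I_r -> 'I_n) : tau (\prod_i lagr i (p i)) = 1.
Proof.
rewrite /tau shear_prod /ufracs -big_split /=.
have E i : shear (lagr i (p i)) * \prod_j ufrac R i j =
    ps_var R (inl i : V) ^+ n.-1 * ufrac R i (p i).
  rewrite /lagr shear_prod [X in _ * X](bigD1 (p i)) //= mulrCA -big_split /= mulrC.
  congr (_ * _); under eq_bigr => j _ do rewrite mulrC ufracE.
  by rewrite prodr_const (cardC1 (p i)) card_ord.
under eq_bigr => i _ do rewrite E.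
rewrite big_split /=.
have -> : \prod_i ps_var R (inl i : V) ^+ n.-1 = umono R (fun=> n.-1) :> ps R V.
  under eq_bigr => i _ do rewrite ps_varE monoX.
  rewrite mono_prod; congr mono; apply: funext => -[] k /=.
    rewrite (bigD1 k) //= {1}/delta eqxx muln1 big1 ?addn0 // => i ni.
    by rewrite /delta (inj_eq inl_inj) eq_sym (negbTE ni) muln0.
  by rewrite big1 // => i _; rewrite muln0.
by rewrite -[X in rho X](addn0 n.-1) rho_raise rho_prod_ufrac.
Qed.

Definition point (p : 'I_r -> 'I_n) (v : V) : ps R 'I_n :=
  match v with inl i => ps_var R (p i) | inr j => ps_var R j end.

Lemma point_ord (p : 'I_r -> 'I_n) (v : V) : ordge 1 (point p v).
Proof. by case: v => i; apply: ordge_var. Qed.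

Definition ppoint (p : 'I_r -> 'I_n) (k : nat) (v : V) : ps R V :=
  match v with
  | inl i => if (i < k)%N then ps_var R (inr (p i) : V) else ps_var R (inl i : V)
  | inr j => ps_var R (inr j : V) end.

Lemma ppoint_ord (p : 'I_r -> 'I_n) k (v : V) : ordge 1 (ppoint p k v).
Proof. by case: v => i /=; first case: ifP => _; apply: ordge_var. Qed.

Definition agree (p0 : {ffun 'I_r -> 'I_n}) k (p : {ffun 'I_r -> 'I_n}) :=
  [forall i : 'I_r, (k <= i)%N ==> (p i == p0 i)].

(* Interpolation in u_1, ..., u_k; the values of p from k on are pinned to those of p0
   so that the sum ranges over the choices of the first k points only. *)
Lemma tau_partial (p0 : {ffun 'I_r -> 'I_n}) f k : (k <= r)%N -> xdisc ^+ k * tau f =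
  \sum_(p : {ffun 'I_r -> 'I_n} | agree p0 k p) tau (subst (ppoint p k) f *
     \prod_(i : 'I_r | (i < k)%N) (embr (xcofactor (p i)) * lagr i (p i))).
Proof.
elim: k => [|k IH] hk.
  rewrite (big_pred1 p0) => [|p].
    rewrite big_pred0 // mulr1 mul1r; congr tau; rewrite -{1}(subst_vars f).
    by apply: eq_subst => -[].
  by apply/forallP/eqP => [h|-> i]; [apply/ffunP => i; apply/eqP/h | rewrite eqxx].
rewrite exprS -mulrA IH 1?ltnW // mulr_sumr.
pose i0 := Ordinal hk.
pose upd (p : {ffun 'I_r -> 'I_n}) q := [ffun i => if i == i0 then q else p i].
pose X (p : {ffun 'I_r -> 'I_n}) := tau (subst (ppoint p k.+1) f *
     \prod_(i : 'I_r | (i < k.+1)%N) (embr (xcofactor (p i)) * lagr i (p i))).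
transitivity (\sum_(p : {ffun 'I_r -> 'I_n} | agree p0 k p) \sum_q X (upd p q)).
  apply: eq_bigr => p _; rewrite -tau_emb.
  set Y := subst _ _ * _; have [g ->] := interpolation i0 Y.
  rewrite tauD tau_vanish addr0 tau_sum; apply: eq_bigr => q _; rewrite /X.
  rewrite (bigD1 i0) /= ?ltnS // ffunE eqxx [in RHS]mulrCA mulrC; congr (tau (_ * _)).
  rewrite /Y substM ?subst_prod; try exact: evu_ord.
  congr (_ * _).
    rewrite subst_comp; [|exact: ppoint_ord|exact: evu_ord].
    apply: eq_subst => -[] i /=; last by rewrite subst_var //; apply: evu_ord.
    rewrite ffunE ltnS [in RHS]leq_eqVlt -[(i : nat) == k]/(i == i0).
    have [->|ni] /= := eqVneq i i0.
      by rewrite ltnn subst_var ?/ev ?eqxx //; apply: evu_ord.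
    case: ifP => _; rewrite subst_var; try exact: evu_ord.
      by [].
    by rewrite /ev (inj_eq inl_inj) (negbTE ni).
  apply: eq_big => [i|i hi].
    rewrite ltnS [in RHS]leq_eqVlt -[(i : nat) == k]/(i == i0).
    by have [->|ni] /= := eqVneq i i0; rewrite ?ltnn ?andbT ?andbF.
  have ni : i != i0 by apply: contraTneq hi => ->; rewrite ltnn.
  rewrite ffunE (negbTE ni) substM ?evu_emb; last exact: evu_ord.
  congr (_ * _); rewrite /lagr subst_prod; last exact: evu_ord.
  by apply: eq_bigr => j _; rewrite evu_du_neq.
rewrite pair_big_dep /=.
(* A map pinned from k + 1 on amounts to a map pinned from k on together with a free value at
   [i0]. *)
rewrite (reindex_onto (fun p : {ffun 'I_r -> 'I_n} => (upd p (p0 i0), p i0)) (fun x => upd x.1 x.2)) /=.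
  have updK (p : {ffun 'I_r -> 'I_n}) : upd (upd p (p0 i0)) (p i0) = p.
    by apply/ffunP => i; rewrite !ffunE; case: eqP => // ->.
  apply: eq_big => [p|p _]; rewrite updK // eqxx !andbT.
  apply/forallP/forallP => h i; apply/implyP => hi.
    have := h i; rewrite ffunE ltnW //=; case: (eqVneq i i0) => [E|//].
    by rewrite E ltnn in hi.
  rewrite ffunE; case: (eqVneq i i0) => [->|ni] //.
  by move: (h i); rewrite ltn_neqAle eq_sym hi andbT ni.
move=> [p q] /= /andP[/forallP/(_ i0) h _]; congr pair; last by rewrite ffunE eqxx.
apply/ffunP => i; rewrite !ffunE; case: eqP => // ->.
by apply/esym/eqP; move: h; rewrite leqnn.
Qed.

Theorem tau_points f : xdisc ^+ r * tau f =
  \sum_(p : {ffun 'I_r -> 'I_n}) subst (point p) f * \prod_i xcofactor (p i).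
Proof.
(* Any base map would do, since agreement from r on is vacuous; r <= n provides one. *)
rewrite (tau_partial [ffun i => widen_ord le_rn i] f (leqnn r)).
apply: eq_big => [p|p _].
  by apply/forallP => i; rewrite leqNgt ltn_ord.
rewrite big_split /= mulrA.
have -> : subst (ppoint p r) f = embr (subst (point p) f).
  rewrite /emb subst_comp; [|exact: point_ord|exact: emb_ord].
  by apply: eq_subst => -[] i /=; rewrite ?ltn_ord subst_var //; apply: emb_ord.
rewrite (eq_bigl xpredT) => [|i]; last by rewrite ltn_ord.
rewrite -emb_prod -embM tau_emb [X in tau X](_ : _ = \prod_i lagr i (p i)).
  by rewrite tau_lagr mulr1.
by apply: eq_bigl => i; rewrite ltn_ord.
Qed.

End Interpolation.

(** * The generating function *)

(** Both bar B and the mixed terms of F(A, bar B) are multiples of B. For B = x_j this makes the h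
    in [frac_ux] a multiple of x_j/u_i, as its x-adic expansion requires. *)
Lemma fgl_sub_factor (R : comNzRingType) (a : nat -> nat -> R) (V : finType) (A B : ps R V) :
  ordge 1 A -> ordge 1 B -> exists Z, fgl_eval a A (ps_bar a B) - A = B * Z.
Proof.
move=> hA hB; have hb := ps_bar_ord a hB; have hp := pair_fun_ord hA hb.
have hv b : ordge 1 (ps_var R (b : bool)) by apply: ordge_var.
have ht : ordge 1 (ps_var R tt) by apply: ordge_var.
pose K : ps R unit := fun m => inv_series a (addm (delta tt) m).
pose K' : ps R bool := fun m => fgl_mixed a (addm (delta false) m).
have barE : ps_bar a B = B * subst (fun=> B) K.
  rewrite ps_barE (@var_divE _ _ tt (inv_series a)) -/K; first by rewrite substM // subst_var.
  by move=> m; rewrite /inv_series => ->.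
have mixE : fgl_mixed a = ps_var R false * K'.
  by rewrite -var_divE // => m; rewrite /fgl_mixed => ->; rewrite andbF.
exists (subst (fun=> B) K * (1 + subst (pair_fun A (ps_bar a B)) K')).
rewrite fgl_evalE mixE substM // subst_var // [pair_fun _ _ false]/= {1 2}barE; ring.
Qed.

Section GenFun.
Variables (R : comNzRingType) (a : nat -> nat -> R) (n : nat) (lam : seq nat).
Local Notation r := (size lam).
Local Notation V := ('I_r + 'I_n)%type.
Hypothesis le_rn : (r <= n)%N.
Variables gamma gamma' : ps R bool.
Hypothesis gammaK : gamma * gamma' = 1.
Hypothesis gammaE : forall (W : finType) (A B : ps R W), ordge 1 A -> ordge 1 B ->
    fgl_eval a A (ps_bar a B) = (A - B) * subst (pair_fun A B) gamma /\
    ps_comp1 (invP_coef a) A = subst (pair_fun A A) gamma.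

Local Notation U i := (ps_var R (inl i : V)).
Local Notation Xv j := (ps_var R (inr j : V)).

Let hU i : ordge 1 (U i). Proof. exact: ordge_var. Qed.
Let hX j : ordge 1 (Xv j). Proof. exact: ordge_var. Qed.

Lemma gammaV (W : finType) (A B : ps R W) : ordge 1 A -> ordge 1 B ->
  subst (pair_fun A B) gamma * subst (pair_fun A B) gamma' = 1.
Proof.
move=> hA hB; have hp := pair_fun_ord hA hB.
by rewrite -substM // gammaK subst1.
Qed.

(** Dividing F(u_i, bar x_j) = (u_i - x_j) gamma by u_i gives 1 + h = (1 - x_j/u_i) gamma, and
    inverses are unique. *)
Lemma Rep_frac_ux i j : Rep (frac_ux a i j) 0
  (ufrac R i j * shear (subst (pair_fun (U i) (Xv j)) gamma')).
Proof.
set g := subst _ gamma'; set t := quot_mono R i j.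
have [Z ZE] := fgl_sub_factor a (hU i) (hX j).
have [FE _] := gammaE (hU i) (hX j).
set h := t * shear Z.
have hE : shear (fgl_eval a (U i) (ps_bar a (Xv j)) - U i) = U i * h.
  by rewrite ZE shearM (shear_xvar R j i) mulrA.
have h1 : 1 + h = (1 - t) * shear (subst (pair_fun (U i) (Xv j)) gamma).
  apply: (@var_lreg R _ (inl i : V)); rewrite mulrDr mulr1 -hE shearB shear_uvar addrC subrK.
  by rewrite FE shearM shearB shear_uvar (shear_xvar R j i) -/t; ring.
have -> : ufrac R i j * shear g = geo h.
  apply: (@inv_uniq _ (1 + h)); last first.
    by apply: geoP; rewrite /h mulrC; apply: ordgeMl; apply: ordge_quot.
  rewrite h1 mulrACA [(1 - t) * _]mulrC ufrac_inv mul1r -shearM gammaV //.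
  exact: shear1.
apply: Rep_geominv.
  rewrite -[1]addr0 /h; apply: wgeM.
    by apply: wge_mono; rewrite ywtE [xpart _](_ : _ = delta j) // mdeg_delta.
  by move=> m; rewrite ywtE.
by apply: Rep_divu; rewrite -hE; apply: Rep_ps.
Qed.

Lemma Rep_frac_uu i j : Rep (frac_uu a n i j) 1
  (umono R (others j) * shear (fgl_eval a (U j) (ps_bar a (U i)))).
Proof.
apply: Rep_divu; rewrite mulrA [X in X * umono R _]umono_var /umono monoM addm_comb addm0.
rewrite addmC others_delta.
by apply: (@Rep_raise R n r _ 0 _ 1); apply: Rep_ps.
Qed.

Definition upairs := [seq p : 'I_r * 'I_r <- enum [set: 'I_r * 'I_r] | (p.1 < p.2)%N].

(* The generating function is kernel / prod_(i, j) (u_i - x_j), up to the monomial that the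
   residue absorbs: 1/F(u_i, bar x_j) = gamma'(u_i, x_j) / (u_i - x_j). *)
Definition kernel : ps R V :=
  (\prod_i (ps_comp1 (invP_coef a) (U i) * \prod_j subst (pair_fun (U i) (Xv j)) gamma')) *
  (umono R (fun i => nth 0 lam i + n - i.+1)%N *
   \prod_(p <- upairs) fgl_eval a (U p.2) (ps_bar a (U p.1))).

Lemma prod_upairs (T : comNzRingType) (F : 'I_r -> 'I_r -> T) :
  \prod_(p <- upairs) F p.1 p.2 = \prod_(j : 'I_r) \prod_(i : 'I_r | (i < j)%N) F i j.
Proof.
rewrite /upairs big_filter big_enum_cond /=.
rewrite (exchange_big_dep xpredT) //= pair_big_dep /=.
by apply: eq_bigl => p; rewrite in_setT.
Qed.

Lemma sum_upairs_snd (k : 'I_r) : (\sum_(p <- upairs) delta k p.2 = k)%N.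
Proof.
rewrite /upairs big_filter big_enum_cond /=.
transitivity (\sum_(i : 'I_r) \sum_(j : 'I_r | i < j) delta k j)%N.
  by rewrite pair_big_dep /=; apply: eq_bigl => p; rewrite in_setT.
transitivity (\sum_(i : 'I_r | i < k) 1)%N.
  rewrite [RHS]big_mkcond; apply: eq_bigr => i _; rewrite big_mkcond (bigD1 k) //= big1.
    by rewrite /delta eqxx addn0.
  by move=> j nj; rewrite /delta (negbTE nj) if_same.
by rewrite (big_ord_narrow (ltnW (ltn_ord k))) /= sum1_card card_ord.
Qed.

(** The variable u_k is absent exactly from the factors of pairs with second index k; counting from
    0, there are k of these. *)
Lemma umono_prod_others :
  \prod_(p <- upairs) umono R (n := n) (others p.2) =
  umono R (fun k => size upairs - k)%N.
Proof.
rewrite /umono mono_prod; congr mono; apply: funext => -[] k /=; last by rewrite big1.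
have H : (\sum_(p <- upairs) others p.2 k + \sum_(p <- upairs) delta k p.2 = size upairs)%N.
  rewrite -big_split /= -[RHS]sum1_size; apply: eq_bigr => p _.
  by rewrite /others /delta eq_sym; case: eqP.
by rewrite -H sum_upairs_snd addnK.
Qed.

Lemma ltn_upairs (k : 'I_r) : (k <= size upairs)%N.
Proof.
rewrite -[X in (X <= _)%N](sum_upairs_snd k) -[X in (_ <= X)%N]sum1_size.
by apply: leq_sum => p _; rewrite /delta; case: eqP.
Qed.

Lemma KL_coeff_tau : KL_coeff_series a n lam = tau kernel.
Proof.
apply: funext => al; rewrite /KL_coeff_series.
have rep1 := fun i => Rep_ps (ps_comp1 (invP_coef a) (U i)).
have rep3 := Rep_prod_cat (l' := [::]) upairs (fun p : 'I_r * 'I_r => Rep_frac_uu p.1 p.2) (@Rep_one R n r).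
rewrite cats0 in rep3.
have := Rep_prod_cat (enum 'I_r) rep1
  (Rep_prod_cat (enum [set: 'I_r * 'I_n]) (fun p : 'I_r * 'I_n => Rep_frac_ux p.1 p.2) rep3).
rewrite -/(KL_genfun a n lam) => /coef_neg_Rep ->.
rewrite !mul0n !add0n mul1n addn0 mulr1; set g := \prod_(i <- enum 'I_r) _ * _; set S := size upairs.
(* The two sides are read at the diagonal exponents S and n - 1; the extra monomials bring both to
   the sum of these. *)
suff E : umono R (fun=> n.-1) * (umono R (fun i => nth 0%N lam i) * g) =
    umono R (fun=> S) * (shear kernel * @ufracs R n r).
  by rewrite -(rho_raise _ n.-1) E addnC rho_raise.
rewrite /g.
have -> : \prod_(p <- enum [set: 'I_r * 'I_n]) (ufrac R p.1 p.2 *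
     shear (subst (pair_fun (U p.1) (Xv p.2)) gamma')) =
   @ufracs R n r * \prod_i \prod_j shear (subst (pair_fun (U i) (Xv j)) gamma').
  rewrite big_enum /= /ufracs !pair_big /= -big_split /=.
  by apply: eq_bigl => p; rewrite in_setT.
rewrite big_split /= umono_prod_others -/S big_enum /=.
rewrite /kernel !shearM !shear_prod shear_umono.
under [in RHS]eq_bigr => i _ do rewrite shearM shear_prod.
rewrite [in RHS]big_split /=.
(* No subtraction truncates, as k <= S and k < r <= n. *)
have mon : umono R (n := n) (fun _ : 'I_r => n.-1) * umono R (fun i : 'I_r => nth 0%N lam i) *
    umono R (fun k => S - k)%N =
  umono R (fun=> S) * umono R (fun i => nth 0 lam i + n - i.+1)%N.
  rewrite /umono !monoM !addm_comb; congr mono; apply: funext => -[] k //=.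
  rewrite /addm; have := ltn_upairs k; rewrite -/S; have := ltn_ord k; lia.
set a1 := \prod_(i : 'I_r) shear _; set a2 := \prod_i \prod_j _; set a3 := \prod_(p <- _) _.
transitivity ((umono R (n := n) (fun _ : 'I_r => n.-1) * umono R (fun i : 'I_r => nth 0%N lam i) *
    umono R (fun k => S - k)%N) * (a1 * (@ufracs R n r * a2) * a3)); first by ring.
by rewrite mon; ring.
Qed.

(** * The contribution of a choice of nodes *)

Local Notation F := (@fgl_xx R a n).

Definition fnode p : ps R 'I_n := \prod_(q | q != p) F p q.

Let hV (p : 'I_n) : ordge 1 (ps_var R p). Proof. exact: ordge_var. Qed.

Lemma fgl_xxE p q : F p q = dx R p q * subst (pair_fun (ps_var R p) (ps_var R q)) gamma.
Proof. exact: (gammaE (hV p) (hV q)).1. Qed.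

Lemma fnode_lreg p : GRing.lreg (fnode p).
Proof.
apply: lreg_prod => q nqp; rewrite fgl_xxE; apply: lregM.
  by apply: dx_lreg; rewrite eq_sym.
by apply: lreg_unitl; apply: gammaV.
Qed.

(** The factor j = p cancels 1/P(x_p) = gamma(x_p, x_p), and the factors j != p turn each F(x_p, bar
    x_j) into x_p - x_j. *)
Lemma weight_node p :
  (ps_comp1 (invP_coef a) (ps_var R p) *
    \prod_j subst (pair_fun (ps_var R p) (ps_var R j)) gamma') * fnode p = xnode R p.
Proof.
rewrite (gammaE (hV p) (hV p)).2 (bigD1 p) //= mulrA gammaV // mul1r.
rewrite /fnode -big_split /=; apply: eq_bigr => j _.
by rewrite fgl_xxE mulrCA [_ * subst _ gamma]mulrC gammaV ?mulr1.
Qed.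

Lemma subst_point_kernel (s : 'I_r -> 'I_n) : subst (point R s) kernel =
  (\prod_i (ps_comp1 (invP_coef a) (ps_var R (s i)) *
     \prod_j subst (pair_fun (ps_var R (s i)) (ps_var R j)) gamma')) *
  (\prod_(i : 'I_r) ps_var R (s i) ^+ (nth 0 lam i + n - i.+1)%N *
   \prod_(j : 'I_r) \prod_(i : 'I_r | (i < j)%N) F (s j) (s i)).
Proof.
have hp := @point_ord R n r s.
rewrite /kernel !substM ?subst_prod //; congr (_ * (_ * _)).
- apply: eq_bigr => i _; rewrite substM // subst_prod // subst_comp1 // subst_var //.
  congr (_ * _); apply: eq_bigr => j _; rewrite subst_comp //; last exact: pair_fun_ord.
  by apply: eq_subst => -[] /=; rewrite subst_var.
- rewrite /umono subst_mono // /mprod big_sumType /= [X in _ * X]big1 ?mulr1 //.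
rewrite -(prod_upairs (fun i j => F (s j) (s i))); apply: eq_bigr => p _.
by rewrite subst_fgl ?subst_bar ?subst_var //; apply: ps_bar_ord.
Qed.

(** For each j, the q other than s j are either earlier values s i with i < j or partners of s j in
    a denominator pair; injectivity makes the index of such a pair unique. *)
Lemma term_node (s : {ffun 'I_r -> 'I_n}) : injective s ->
  \prod_i fnode (s i) = (\prod_(j : 'I_r) \prod_(i : 'I_r | (i < j)%N) F (s j) (s i)) *
    \prod_(p <- offdiag n | den_pair s p.1 p.2) F p.1 p.2.
Proof.
move=> inj_s.
have -> : \prod_(p <- offdiag n | den_pair s p.1 p.2) F p.1 p.2 =
    \prod_(i : 'I_r) \prod_(q | [forall k : 'I_r, (k <= i)%N ==> (s k != q)]) F (s i) q.
  transitivity (\prod_p \prod_(q | (p != q) && den_pair s p q) F p q).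
    rewrite /offdiag big_filter_cond big_enum_cond /= pair_big_dep /=.
    by apply: eq_bigl => p; rewrite in_setT.
  rewrite (bigID (mem (s @: setT))) /= [X in _ * X]big1 ?mulr1 => [|p nps]; last first.
    apply: big_pred0 => q; apply/negbTE; rewrite negb_and; apply/orP; right.
    by apply: contraNN nps => /existsP[i /andP[/eqP <- _]]; apply: imset_f.
  rewrite big_imset /=; last by move=> ? ? _ _; apply: inj_s.
  apply: eq_big => [i|i _]; first by rewrite in_setT.
  apply: eq_bigl => q; apply/andP/forallP => [[_ /existsP[i' /andP[/eqP/inj_s -> /forallP]]] //|h].
  split; first by have := h i; rewrite leqnn.
  by apply/existsP; exists i; rewrite eqxx; apply/forallP.
rewrite -big_split /=; apply: eq_bigr => j _; rewrite /fnode.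
rewrite (bigID (fun q => q \in s @: [set i : 'I_r | (i < j)%N])) /=; congr (_ * _).
  transitivity (\prod_(q in s @: [set i : 'I_r | (i < j)%N]) F (s j) q).
    apply: eq_bigl => q; case: imsetP => [[i]|]; rewrite ?andbT ?andbF // inE => ij ->.
    by rewrite (inj_eq inj_s); apply: contraTneq ij => ->; rewrite ltnn.
  rewrite big_imset /=; last by move=> ? ? _ _; apply: inj_s.
  by apply: eq_bigl => i; rewrite inE.
apply: eq_bigl => q; apply/andP/forallP => [[nq nim] k|h].
  apply/implyP; rewrite leq_eqVlt => /orP[/eqP/val_inj -> |kj]; first by rewrite eq_sym.
  by apply: contraNneq nim => <-; apply: imset_f; rewrite inE.
split; first by have := h j; rewrite leqnn eq_sym.
by apply/imsetP => -[k]; rewrite inE => kj E; have := h k; rewrite ltnW //= E eqxx.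
Qed.

Lemma KL_term_numE (s : {ffun 'I_r -> 'I_n}) : KL_term_num a s =
  \prod_(i : 'I_r) ps_var R (s i) ^+ (nth 0 lam i + n - i.+1)%N *
  \prod_(p <- offdiag n | ~~ den_pair s p.1 p.2) F p.1 p.2.
Proof.
rewrite /KL_term_num !ps_prodE big_map big_enum big_map big_filter /=.
by congr (_ * _); apply: eq_bigr => i _; rewrite ps_expE.
Qed.

(** The product of the [fnode (s i)], which is regular, plays two roles: by [weight_node] it clears
    the weights, leaving [xdisc] to the power r after the cofactors; by [term_node] it converts the
    numerator of the kernel into the denominator of the summand. *)
Lemma point_term (s : {ffun 'I_r -> 'I_n}) : injective s ->
  subst (point R s) kernel * \prod_i xcofactor R (s i) * @KL_den R a n =
  @xdisc R n ^+ r * KL_term_num a s.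
Proof.
move=> inj_s; have L : GRing.lreg (\prod_i fnode (s i)).
  by apply: lreg_prod => i _; apply: fnode_lreg.
apply: L; rewrite subst_point_kernel KL_term_numE.
set W := \prod_i (_ * _); set m := \prod_(i : 'I_r) _ ^+ _; set G := \prod_(j : 'I_r) \prod_(i : 'I_r | (i < j)%N) F (s j) (s i).
set N := \prod_(p <- _ | ~~ _) _.
have hW : \prod_i fnode (s i) * W * \prod_i xcofactor R (s i) = @xdisc R n ^+ r.
  rewrite -!big_split /= -[r in RHS]card_ord -prodr_const; apply: eq_bigr => i _.
  by rewrite [fnode _ * _]mulrC weight_node mulrC xcofactorE.
have hD : @KL_den R a n = (\prod_(p <- offdiag n | den_pair s p.1 p.2) F p.1 p.2) * N.
  by rewrite /KL_den ps_prodE big_map (bigID (fun p => den_pair s p.1 p.2)).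
transitivity ((\prod_i fnode (s i) * W * \prod_i xcofactor R (s i)) * (m * (G * @KL_den R a n))).
  by ring.
by rewrite hW hD (term_node inj_s) -/G; ring.
Qed.

Lemma point_noninj (s : 'I_r -> 'I_n) i j : i != j -> s i = s j ->
  subst (point R s) kernel = 0.
Proof.
wlog ij : i j / (i < j)%N => [H nij E|_ E].
  case: (ltngtP i j) => [|lt|/val_inj eq]; last by rewrite eq eqxx in nij.
    by move/H; apply.
  by apply: (H j i) => //; rewrite eq_sym.
rewrite subst_point_kernel [X in _ * (_ * X)](bigD1 j) //= (bigD1 i (P := fun k => k < j)%N) //= E.
by rewrite [F _ _]fgl_bar // !mul0r !mulr0.
Qed.

Lemma KL_coeff_den :
  KL_coeff_series a n lam * @KL_den R a n =
  \sum_(s : {ffun 'I_r -> 'I_n} | injectiveb s) KL_term_num a s.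
Proof.
apply: (lregX (n := r) (@xdisc_lreg R n)).
rewrite mulrA KL_coeff_tau tau_points // mulr_suml mulr_sumr [LHS](bigID (fun s : {ffun 'I_r -> 'I_n} => injectiveb s)) /=.
rewrite [X in _ + X]big1 ?addr0 => [|s /injectivePn[i [j nij E]]]; last first.
  by rewrite (point_noninj nij E) !mul0r.
by apply: eq_bigr => s /injectiveP; apply: point_term.
Qed.

End GenFun.

Theorem mainTheorem4 (R : comNzRingType) (a : nat -> nat -> R) (n : nat) (lam : seq nat) :
  is_fgl a -> is_partition lam -> (size lam <= n)%N ->
  is_KL_schur a n lam (KL_coeff_series a n lam).
Proof.
move=> fgla _ le_rn m.
have [gamma [gamma0 gammaE]] := fgl_difference fgla.
have [gamma' gammaK] := ps_unit_ex gamma0.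
rewrite -[LHS]/((KL_coeff_series a n lam * @KL_den R a n) m).
by rewrite (KL_coeff_den le_rn gammaK gammaE) ps_sumE.
Qed.
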